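(* Let $\mathfrak{e}\subset\mathbb{R}$ be a compact, not finite set. Then for every $n$, $$\|T_n\|_{\mathfrak{e}} \le 2\exp(PW(\mathfrak{e}))\, C(\mathfrak{e})^n .$$ Moreover, if for some such $\mathfrak{e}\subset\mathbb{R}$ and some $n$ equality holds in this inequality, then $\mathfrak{e}$ is an interval.
   Context: For a compact, not finite set $\mathfrak{e}\subset\mathbb{C}$, $\|f\|_{\mathfrak{e}} = \sup_{z\in\mathfrak{e}}|f(z)|$, and the Chebyshev polynomial $T_n$ of $\mathfrak{e}$ is the unique monic polynomial of degree $n$ minimizing $\|P\|_{\mathfrak{e}}$ over all monic polynomials $P$ of degree $n$. $C(\mathfrak{e})$ denotes the logarithmic capacity of $\mathfrak{e}$, and $G_{\mathfrak{e}}$ denotes the potential-theoretic Green's function of $\mathfrak{e}$ (with pole at $\infty$). The Parreau--Widom sum is $PW(\mathfrak{e}) = \sum_{w\in\mathcal{C}} G_{\mathfrak{e}}(w)$, where $\mathcal{C}$ is the set of critical points (in $\mathbb{C}$) of $G_{\mathfrak{e}}$ (when $\mathfrak{e}\subset\mathbb{R}$, they lie in $\mathbb{R}$).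
   Formalization: The formal theorem adds that the Green's function vanishes at the endpoints of every bounded gap of e (implied by regularity of e). Without it the claim fails: for e = [-1,1] ∪ {2}, PW(e) = 0, C(e) = 1/2, but ‖T_1‖ = 3/2 > 1. Sets of zero capacity have no Green's function. *)

(* Defs.v *)
From HB Require Import structures.
From mathcomp Require Import all_boot all_order all_algebra.
From mathcomp Require Import complex.
From mathcomp Require Import all_classical all_reals all_analysis.

Set Implicit Arguments.
Unset Strict Implicit.
Unset Printing Implicit Defensive.

Import Order.TTheory GRing.Theory Num.Theory.
Import ComplexField.Normc.
Import numFieldNormedType.Exports.

Local Open Scope classical_set_scope.
Local Open Scope complex_scope.
Local Open Scope ring_scope.

Section Chebyshev.
Context {R : realType}.
Implicit Types (e : set R) (P T : {poly R[i]}).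

Definition sup_norm e P : R := sup [set normc P.[x%:C] | x in e].

(* The minimization runs over monic polynomials with complex coefficients;
   the minimizer is unique as soon as e is compact and infinite. *)
Definition is_chebyshev e (n : nat) T : Prop :=
  [/\ T \is monic, size T = n.+1 &
      forall P, P \is monic -> size P = n.+1 -> sup_norm e T <= sup_norm e P].

End Chebyshev.

Section PotentialTheory.
Context {R : realType}.
Implicit Types (e : set R) (mu rho : probability (measurableTypeR R) R)
  (z w : R[i]).

Local Open Scope ereal_scope.

(* log (1 / |z - w|); unlike [ln], [lne] has lne 0 = -oo, so that the kernel is
   +oo on the diagonal and measures with atoms have infinite energy. *)
Definition log_kernel z w : \bar R := - lne (normc (z - w))%:E.

Definition potential mu z : \bar R := \int[mu]_t log_kernel z t%:C.

Definition energy mu : \bar R := \int[mu]_x potential mu x%:C.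

Definition supported_on e mu : Prop := mu (~` e) = 0.

(* Robin constant; +oo exactly when e is polar. *)
Definition robin e : \bar R :=
  ereal_inf [set energy mu | mu in [set mu | supported_on e mu]].

Definition capacity e : \bar R := expeR (- robin e).

(* For compact e of positive capacity there is exactly one such measure. *)
Definition is_equilibrium e rho : Prop :=
  supported_on e rho /\ energy rho = robin e.

(* Green's function of e with pole at infinity, on the whole complex plane,
   where rho is the equilibrium measure of e. *)
Definition green e rho z : \bar R := robin e - potential rho z.

(* G as a real-valued function of the two real variables (Re z, Im z). *)
Definition green2 e rho (p : R * R) : R := fine (green e rho (p.1 +i* p.2)).

Definition green_critical e rho : set R[i] :=
  [set w | differentiable (green2 e rho) (complex.Re w, complex.Im w) /\
           forall v : R * R, ('d (green2 e rho) (complex.Re w, complex.Im w) v = 0)%R].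

Definition PW e rho : \bar R := esum (green_critical e rho) (green e rho).

(* The endpoints of every bounded component ]a, b[ of the complement of e in the
   real line are regular points, i.e. zeros of the Green's function.  This
   follows from regularity of e (G = 0 on e).  Some such condition is implicit
   in the definition of PW: for e = [-1, 1] `|` {2} the Green's function is that
   of [-1, 1], it has no critical point, and the sum is empty although e has a
   gap.  For compact infinite e the condition also forces robin e < +oo, so
   that G exists. *)
Definition gap_regular e rho : Prop :=
  forall a b : R, (a < b)%R -> e a -> e b ->
    (forall x : R, (a < x < b)%R -> ~ e x) ->
    green e rho a%:C = 0 /\ green e rho b%:C = 0.

End PotentialTheory.

(* Main.v *)
Require Import Defs.
From HB Require Import structures.
From mathcomp Require Import all_boot all_order all_algebra.
From mathcomp Require Import complex.
From mathcomp Require Import all_classical all_reals all_analysis.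
From mathcomp Require Import measurable_realfun ring lra.

Set Implicit Arguments.
Unset Strict Implicit.
Unset Printing Implicit Defensive.

Import Order.TTheory GRing.Theory Num.Theory.
Import numFieldNormedType.Exports.

Local Open Scope classical_set_scope.
Local Open Scope complex_scope.
Local Open Scope ring_scope.

(** Let M be the norm of T on e.  Taking real parts of coefficients, T may be
    replaced by a real extremal polynomial P.  For |y| < M extremality shows
    that P - y = prod (X - r_j) with real roots in the convex hull of e, at
    most one in each gap: if A divides P - y and A > 0 on e, then replacing A
    by A - eps moves P strictly towards y on e.  With rho the equilibrium
    measure, R the Robin constant and n the degree, integrating
    log |P - y| = sum log |t - r_j| gives

      sum_j G(r_j) = n R + int log |P(t) - y| drho(t).

    A root in a gap contributes at most the maximum of G there, which is its
    value at a critical point, and, by Frostman's variational argument, G <= 0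
    on e outside a Lebesgue null set.  So for almost every y
    n R + int log |P - y| drho <= PW(e).  To replace the integral by log (M/2),
    which is its mean over y for the arcsine law on [-M, M], one iterates the
    map q(s) = 2 s^2 / M - M: since q(P) - z = (2/M) (P - y) (P + y) with
    q(y) = z, a bound for P doubles for q(P), while the mean of
    int log |Q - z| drho over z in [-M, M] is bounded below for all Q with
    |Q| <= M.  If e has a gap, G stays away from its maximum over this gap
    unless y is close to the value of P at the maximum, so that the final
    inequality is strict. *)

(** * Extremal polynomials and their roots *)

(** Two obstacles shape the proof. First, G <= 0 on [e] is obtained only off a null set [B], so a
    root lying in [B] must be avoided. [P] is Lipschitz on [e], hence P(B) is null and almost every
    y is harmless. The map q is Lipschitz on [-M, M], so iterating it keeps the same [B] and only
    changes its null image.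

    Second, the arcsine mean of log |s - y| is never computed. Averaging over y for Lebesgue measure
    gives a bound that is wrong by a constant, but this constant does not depend on the function.
    Each composition with q doubles the distance of the bound from its fixed point, so no positive
    distance can survive. The fixed point corresponds to log (M / 2), where M / 2 is the capacity of
    [-M, M]; this is the origin of the factor 2.

    All potentials are taken with the nonnegative kernel log (C / |u|), which shifts them by log C.
    Thus G appears below as the Robin constant plus log C minus [logpot], and upper bounds for G
    become lower bounds for [logpot]. *)

Section ExtremalPolynomial.
Context {R : realType}.
Implicit Types (e : set R) (P Q A W : {poly R}) (M : R).

Definition extremal e P M : Prop :=
  [/\ P \is monic, (forall x, e x -> `|P.[x]| <= M) &
      forall Q m, Q \is monic -> size Q = size P ->
        (forall x, e x -> `|Q.[x]| <= m) -> M <= m].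

Lemma normc_real (x : R) : Normc.normc x%:C = `|x|.
Proof. by rewrite /Normc.normc /= expr0n addr0 sqrtr_sqr. Qed.

Lemma horner_Re (T : {poly R[i]}) (x : R) :
  (map_poly (@complex.Re R) T).[x] = complex.Re T.[x%:C].
Proof.
rewrite (@horner_coef_wide _ (size T)) ?size_poly// horner_coef.
rewrite raddf_sum; apply: eq_bigr => i _.
rewrite coef_map_id0// -rmorphXn /=.
by case: (T`_i) => a b /=; rewrite mulr0 subr0.
Qed.

(** Without boundedness [sup] takes a default value, and [sup_norm] would not be an upper bound. *)
Lemma compact_poly_bounded e (T : {poly R[i]}) : compact e ->
  exists m, forall x, e x -> Normc.normc T.[x%:C] <= m.
Proof.
move=> /compact_bounded[b [_ /(_ (b + 1))]]; rewrite ltrDl ltr01 => /(_ isT) be.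
exists (\sum_(i < size T) Normc.normc T`_i * (b + 1) ^+ i) => x ex.
rewrite horner_coef.
have sum_le (I : seq 'I_(size T)) (F : 'I_(size T) -> R[i]) :
    Normc.normc (\sum_(i <- I) F i) <= \sum_(i <- I) Normc.normc (F i).
  elim/big_ind2: _ => //; first by rewrite Normc.normc0.
  by move=> u v w z uv wz; apply: (le_trans (le_normcD _ _)); exact: lerD.
apply: (le_trans (sum_le _ _)); apply: ler_sum => i _.
rewrite Normc.normcM -rmorphXn normc_real ler_wpM2l//.
  by case: (T`_i) => a c; rewrite /Normc.normc sqrtr_ge0.
by rewrite normrX lerXn2r ?nnegrE//; [exact: le_trans (be _ ex)|exact: be].
Qed.

(* P consists of the real parts of the coefficients of T:
   |Re T(x)| <= |T(x)| for real x. *)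
Lemma is_chebyshev_extremal e n (T : {poly R[i]}) :
  compact e -> e !=set0 -> is_chebyshev e n T ->
  exists2 P : {poly R}, size P = n.+1 & extremal e P (sup_norm e T).
Proof.
move=> ce [x0 ex0] [mT sT minT].
have lT : T`_n = 1 by move/monicP: mT; rewrite lead_coefE sT.
have sup_le S m : (forall x, e x -> Normc.normc S.[x%:C] <= m) ->
    sup_norm e S <= m.
  move=> Sm; apply: ge_sup; first by exists (Normc.normc S.[x0%:C]), x0.
  by move=> _ [x ex <-]; exact: Sm.
have le_sup S x : e x -> Normc.normc S.[x%:C] <= sup_norm e S.
  move=> ex; apply: ub_le_sup; last by exists x.
  by have [m mS] := compact_poly_bounded S ce; exists m => _ [y ey <-]; exact: mS.
have sP : size (map_poly (@complex.Re R) T) = n.+1.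
  by rewrite size_map_poly_id0 ?sT// (monicP mT) /= oner_neq0.
exists (map_poly (@complex.Re R) T) => //; split.
- by apply/monicP; rewrite lead_coefE sP coef_map_id0//= lT.
- move=> x ex; rewrite horner_Re; apply: le_trans (le_sup _ _ ex).
  case: (T.[_]) => a b /=.
  by rewrite -sqrtr_sqr ler_wsqrtr// lerDl sqr_ge0.
- move=> Q m mQ sQ Qm.
  apply: le_trans (minT (map_poly (real_complex R) Q) _ _) _.
  + by rewrite map_monic.
  + by rewrite size_map_poly sQ sP.
  + by apply: sup_le => x ex; rewrite horner_map normc_real; exact: Qm.
Qed.

Lemma poly_positive_bounds e A : compact e -> e !=set0 ->
  (forall x, e x -> 0 < A.[x]) ->
  exists lo hi, 0 < lo /\ forall x, e x -> lo <= A.[x] <= hi.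
Proof.
move=> ce e0 A0.
have cA : {within e, continuous (horner A)}.
  by apply: continuous_subspaceT => x; exact: continuous_horner.
have [c /set_mem ec cle] := compact_EVT_min e0 ce cA.
have [d _ led] := compact_EVT_max e0 ce cA.
exists A.[c], A.[d]; split => [|x /mem_set ex]; first exact: A0.
by rewrite cle// led.
Qed.

(* If A divides P - y and is positive on e, then
   P - s W = (1 - s/A) P + (s/A) y with W = (P - y)/A and small s > 0
   has a smaller sup norm than P. *)
Lemma extremal_no_positive_factor e P M y A W :
  compact e -> e !=set0 -> extremal e P M -> `|y| < M ->
  P - y%:P = A * W -> (size W < size P)%N ->
  (forall x, e x -> 0 < A.[x]) -> False.
Proof.
move=> ce e0 [mP PM minP] yM PE sW A0.
have [lo [hi [lo0 lohi]]] := poly_positive_bounds ce e0 A0.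
have hi0 : 0 < hi.
  by have [x ex] := e0; have /andP[h1 h2] := lohi _ ex; apply: lt_le_trans (le_trans h1 h2).
(* The competitor is [P - lo *: W]: the weight s = lo / A(x) then stays in [lo / hi, 1] on [e], so
   the gain is uniform in x. *)
have : M <= M - lo / hi * (M - `|y|).
  apply: (minP (P - lo *: W)).
  - rewrite monicE lead_coefDl ?(monicP mP)//.
    by rewrite size_polyN (leq_ltn_trans (size_scale_leq _ _)).
  - by rewrite size_polyDl// size_polyN (leq_ltn_trans (size_scale_leq _ _)).
  move=> x ex; have /andP[h1 h2] := lohi _ ex; have Ax := A0 _ ex.
  have Wx : W.[x] = (P.[x] - y) / A.[x].
    have := congr1 (horner^~ x) PE; rewrite !hornerE => ->.
    by rewrite mulrC mulKf ?gt_eqF.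
  set s := lo / A.[x].
  have s1 : s <= 1 by rewrite ler_pdivrMr// mul1r.
  have s0 : lo / hi <= s by rewrite ler_pM2l// lef_pV2.
  have s00 : 0 <= s by rewrite divr_ge0// ltW.
  have -> : (P - lo *: W).[x] = (1 - s) * P.[x] + s * y.
    by rewrite !hornerE Wx /s; field; rewrite gt_eqF.
  clearbody s; apply: (le_trans (ler_normD _ _)).
  rewrite !normrM (ger0_norm s00) ger0_norm ?subr_ge0//.
  apply: (@le_trans _ _ ((1 - s) * M + s * `|y|)).
    by rewrite lerD2r ler_wpM2l ?subr_ge0 ?PM.
  have -> : (1 - s) * M + s * `|y| = M - s * (M - `|y|) by ring.
  by rewrite lerD2l lerN2 ler_wpM2r// subr_ge0 ltW.
apply/negP; rewrite -ltNge ltrBlDr ltrDl mulr_gt0 ?divr_gt0 ?subr_gt0//.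
Qed.

End ExtremalPolynomial.

Section ExtremalRoots.
Context {R : realType}.
Implicit Types (e : set R) (P Q A W : {poly R}) (M : R).

Lemma size_cofactor A W P : P != 0 -> P = A * W -> (1 < size A)%N ->
  (size W < size P)%N.
Proof.
move=> P0 PE sA; have := P0; rewrite PE mulf_eq0 negb_or => /andP[A0 W0].
rewrite size_mul//; move: sA; case: (size A) => [|[|k]]// _.
by rewrite !addSn /= ltnS leq_addl.
Qed.

(** The remainder modulo the quadratic is real, of degree at most 1, and vanishes at the nonreal
    point z; so it is 0. *)
Lemma nonreal_root_factor P (z : R[i]) :
  root (map_poly (real_complex R) P) z -> complex.Im z != 0 ->
  exists W, P = (('X - (complex.Re z)%:P) ^+ 2 + ((complex.Im z) ^+ 2)%:P) * W.
Proof.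
case: z => a b /= rz b0; set A := (_ + _).
have sX : size (('X - a%:P) ^+ 2 : {poly R}) = 3.
  by rewrite size_exp_XsubC.
have sA : size A = 3 by rewrite size_polyDl sX// (leq_ltn_trans (size_polyC_leq1 _)).
have hz Q : (map_poly (real_complex R) (A * Q)).[a +i* b] = 0.
  rewrite rmorphM hornerM [X in X * _](_ : _ = 0) ?mul0r//.
  rewrite /A rmorphD rmorphXn rmorphB /= map_polyX !map_polyC /= !hornerE /=.
  by apply/eqP; rewrite eq_complex /=; apply/andP; split; apply/eqP; ring.
exists (P %/ A); rewrite mulrC {1}(divp_eq P A).
suff -> : P %% A = 0 by rewrite addr0.
have A0 : A != 0 by rewrite -size_poly_gt0 sA.
have := ltn_modp P A; rewrite A0 sA; move rE : (P %% A) => r sr.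
have rE2 : r = r`_1 *: 'X + (r`_0)%:P.
  apply/polyP => i; rewrite coefD coefZ coefX coefC.
  case: i => [|[|i]] /=; rewrite ?mulr0 ?mulr1 ?add0r ?addr0//.
  by apply: nth_default; move: sr; rewrite ltnS => /leq_trans; apply.
have : (map_poly (real_complex R) r).[a +i* b] = 0.
  move/eqP: rz; rewrite {1}(divp_eq P A) rE rmorphD hornerD mulrC.
  by rewrite hz add0r.
rewrite rE2 rmorphD /= linearZ /= map_polyX map_polyC /= !hornerE /=.
move/eqP; rewrite eq_complex /= => /andP[/eqP + /eqP].
rewrite !mul0r !addr0 => E1 E2.
have r1 : r`_1 = 0.
  move/eqP: E2; rewrite ?subr0 ?addr0 mulf_eq0 => /orP[/eqP//|].
  by rewrite (negPf b0).
move: E1; rewrite r1 mul0r subr0 add0r => ->.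
by rewrite scale0r add0r.
Qed.

(** A pair of nonreal roots a +- ib would yield the factor (X - a)^2 + b^2, which is positive on the
    whole line. *)
Lemma extremal_real_roots e P M y :
  compact e -> e !=set0 -> extremal e P M -> `|y| < M -> (1 < size P)%N ->
  exists2 rs : seq R, size rs = (size P).-1 &
    P - y%:P = \prod_(r <- rs) ('X - r%:P).
Proof.
move=> ce e0 ext yM sP.
have sPy : size (P - y%:P) = size P.
  by rewrite size_polyDl// size_polyN (leq_ltn_trans (size_polyC_leq1 _)).
have mPy : P - y%:P \is monic.
  case: ext => /monicP mP _ _; rewrite monicE lead_coefDl ?mP//.
  by rewrite size_polyN (leq_ltn_trans (size_polyC_leq1 _)).
have [zs zsE] := closed_field_poly_normal (map_poly (real_complex R) (P - y%:P)).
have zs1 : map_poly (real_complex R) (P - y%:P) = \prod_(z <- zs) ('X - z%:P).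
  by rewrite zsE lead_coef_map (monicP mPy) rmorph1 scale1r.
have zsR z : z \in zs -> z = (complex.Re z)%:C.
  move=> zzs; have rz : root (map_poly (real_complex R) (P - y%:P)) z.
    by rewrite zs1 root_prod_XsubC.
  have [Im0|Im0] := eqVneq (complex.Im z) 0.
    by apply/eqP; rewrite eq_complex /= eqxx Im0 eqxx.
  have [W PE] := nonreal_root_factor rz Im0.
  exfalso; apply: (extremal_no_positive_factor ce e0 ext yM PE).
    rewrite -sPy; apply: (size_cofactor (monic_neq0 mPy) PE).
    rewrite size_polyDl size_exp_XsubC//.
    by rewrite (leq_ltn_trans (size_polyC_leq1 _)).
  move=> x _; rewrite !hornerE ltr_wpDl ?sqr_ge0//; rewrite exprn_even_gt0 ?Im0 ?orbT //.
exists (map (@complex.Re R) zs).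
  rewrite size_map -sPy.
  by have := congr1 (size \o polyseq) zs1; rewrite /= size_map_poly size_prod_XsubC => ->.
apply: (map_poly_inj (real_complex R)); rewrite zs1 rmorph_prod big_map /=.
rewrite big_seq [RHS]big_seq; apply: eq_bigr => z /zsR zE.
by rewrite rmorphB /= map_polyX map_polyC /= -zE.
Qed.

(** The positive factor is r - X or X - r, according to the side on which [e] lies. *)
Lemma extremal_root_not_separated e P M y rs r :
  compact e -> e !=set0 -> extremal e P M -> `|y| < M -> (1 < size P)%N ->
  P - y%:P = \prod_(r <- rs) ('X - r%:P) -> r \in rs ->
  (forall x, e x -> x < r) \/ (forall x, e x -> r < x) -> False.
Proof.
move=> ce e0 ext yM sP PE rrs.
have sPy : size (P - y%:P) = size P.
  by rewrite size_polyDl// size_polyN (leq_ltn_trans (size_polyC_leq1 _)).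
have P0 : P - y%:P != 0 by rewrite -size_poly_gt0 sPy ltnW.
move: PE; rewrite (big_rem _ rrs) /=; set W := (\prod_(_ <- rem _ _) _) => PE [h|h].
- have PE' : P - y%:P = (r%:P - 'X) * (- W) by rewrite mulrN -mulNr opprB.
  apply: (extremal_no_positive_factor ce e0 ext yM PE').
    by rewrite -sPy; apply: (size_cofactor P0 PE'); rewrite -opprB size_polyN size_XsubC.
  by move=> x /h; rewrite !hornerE subr_gt0.
- apply: (extremal_no_positive_factor ce e0 ext yM PE).
    by rewrite -sPy; apply: (size_cofactor P0 PE); rewrite size_XsubC.
  by move=> x /h; rewrite !hornerE subr_gt0.
Qed.

Lemma extremal_roots_in_hull e P M y rs l u r :
  compact e -> e !=set0 -> extremal e P M -> `|y| < M -> (1 < size P)%N ->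
  P - y%:P = \prod_(r <- rs) ('X - r%:P) -> (forall x, e x -> l <= x <= u) ->
  r \in rs -> l <= r <= u.
Proof.
move=> ce e0 ext yM sP PE elu rrs.
apply/andP; split; rewrite leNgt; apply/negP => h;
  apply: (extremal_root_not_separated ce e0 ext yM sP PE rrs); [right|left];
  move=> x /elu /andP[lx xu].
  exact: lt_le_trans lx.
exact: le_lt_trans xu _.
Qed.

(** The positive factor is (X - r)(X - r'). The case r = r' is included, so a gap contains neither
    two roots nor a double root. *)
Lemma extremal_roots_separated e P M y r r' rs :
  compact e -> e !=set0 -> extremal e P M -> `|y| < M -> (1 < size P)%N ->
  P - y%:P = \prod_(r <- [:: r, r' & rs]) ('X - r%:P) ->
  (forall x, e x -> 0 < (x - r) * (x - r')) -> False.
Proof.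
move=> ce e0 ext yM sP.
have sPy : size (P - y%:P) = size P.
  by rewrite size_polyDl// size_polyN (leq_ltn_trans (size_polyC_leq1 _)).
have P0 : P - y%:P != 0 by rewrite -size_poly_gt0 sPy ltnW.
rewrite !big_cons mulrA => PE h.
apply: (extremal_no_positive_factor ce e0 ext yM PE).
  rewrite -sPy; apply: (size_cofactor P0 PE).
  by rewrite size_mul ?polyXsubC_eq0// !size_XsubC.
by move=> x /h; rewrite !hornerE.
Qed.

(** Applied to the map from roots to critical points: two roots with the same image are brought to
    the front of the product. *)
Lemma not_uniq_map_perm (T T' : eqType) (f : T -> T') (s : seq T) :
  ~~ uniq (map f s) ->
  exists x y s', perm_eq s [:: x, y & s'] /\ f x = f y.
Proof.
elim: s => //= x s IH; rewrite negb_and negbK => /orP[/mapP[y ys fxy]|/IH].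
  by exists x, y, (rem y s); split => //; rewrite perm_cons perm_to_rem.
move=> [y [z [s' [ps fyz]]]]; exists y, z, (x :: s'); split => //.
rewrite (perm_trans (_ : perm_eq (x :: s) (x :: [:: y, z & s'])))//.
  by rewrite perm_cons.
by rewrite (perm_catCA [:: x] [:: y; z] s').
Qed.

End ExtremalRoots.

(** * The logarithmic kernel *)

Section LogKernel.
Context {R : realType}.
Implicit Types (C D u v x t : R).
Local Open Scope ereal_scope.

(* For C > 0: log (C / |u|) truncated from below at 0.  It differs from the
   logarithmic kernel by log C as long as |u| <= C, and being nonnegative it
   is amenable to Tonelli's theorem. *)
Definition kap C u : \bar R :=
  if u == 0%R then +oo else (Num.max (ln C - ln `|u|)%R 0)%:E.

Lemma kap_ge0 C u : 0 <= kap C u.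
Proof. by rewrite /kap; case: ifP => // _; rewrite lee_fin le_max lexx orbT. Qed.

Lemma kapN C u : kap C (- u)%R = kap C u.
Proof. by rewrite /kap oppr_eq0 normrN. Qed.

Lemma kapE C u : (u != 0)%R -> (`|u| <= C)%R ->
  kap C u = (ln C - ln `|u|)%:E.
Proof.
move=> u0 uC; have ugt0 : (0 < `|u|)%R by rewrite normr_gt0.
have C0 := lt_le_trans ugt0 uC.
rewrite /kap (negPf u0); congr EFin; apply/max_idPl.
by rewrite subr_ge0 ler_ln.
Qed.

Lemma measurable_kap C : measurable_fun [set: R] (kap C).
Proof.
rewrite /kap; apply: measurable_fun_ifT => //=.
  exact: measurable_fun_eqr.
apply/measurable_EFinP; apply: measurable_maxr => //.
apply: measurable_funB => //.
apply: (measurableT_comp (@measurable_ln R)).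
exact: normr_measurable.
Qed.

Lemma log_kernelE C x t : (0 < C)%R -> (`|x - t| <= C)%R ->
  log_kernel x%:C t%:C = kap C (x - t) - (ln C)%:E.
Proof.
move=> C0 xtC; rewrite /log_kernel -rmorphB normc_real.
have [/eqP xt0|xt0] := boolP (x - t == 0)%R.
  by rewrite xt0 normr0 /lne lexx /kap eqxx.
rewrite lne_EFin ?normr_gt0// kapE// -EFinN -EFinD.
by congr (_%:E); rewrite addrAC subrr add0r.
Qed.

Lemma kapM C D u v : (`|u| <= C)%R -> (`|v| <= D)%R ->
  kap (C * D) (u * v) = kap C u + kap D v.
Proof.
move=> uC vD.
have [->|u0] := eqVneq u 0%R.
  by rewrite mul0r {1 2}/kap eqxx addye// gt_eqF// (lt_le_trans _ (kap_ge0 _ _)).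
have [->|v0] := eqVneq v 0%R.
  by rewrite mulr0 {1 3}/kap eqxx addey// gt_eqF// (lt_le_trans _ (kap_ge0 _ _)).
have u00 : (0 < `|u|)%R by rewrite normr_gt0.
have v00 : (0 < `|v|)%R by rewrite normr_gt0.
have C0 := lt_le_trans u00 uC; have D0 := lt_le_trans v00 vD.
rewrite !kapE ?mulf_neq0//; last by rewrite normrM ler_pM.
rewrite -EFinD; congr EFin; rewrite normrM !lnM ?posrE//; ring.
Qed.

(** If C / 2^(N+1) < |u| <= C / 2^N, the series counts the N + 1 indices 0, ..., N, and log (C /
    |u|) < (N + 1) log 2. This turns the integral of the logarithm into a geometric series. *)
Lemma kap_dyadic C u : (0 < C)%R ->
  kap C u <= (ln 2)%:E *
    \sum_(0 <= i <oo) (\1_(`[- (C / (2 ^ i)%:R), C / (2 ^ i)%:R]%classic) u : R)%:E.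
Proof.
move=> C0; set S := \sum_(0 <= i <oo) _.
have ln2 : (0 < ln 2 :> R)%R by rewrite ln_gt0// ltr1n.
have pw i : (0 < (2 ^ i)%:R :> R)%R by rewrite ltr0n expn_gt0.
have ind N : (`|u| <= C / (2 ^ N)%:R)%R -> N.+1%:R%:E <= S.
  move=> uN; apply: le_trans (@nneseries_lim_ge R _ xpredT 0 N.+1 _) => //.
  rewrite (eq_big_nat _ _ (F2 := fun=> 1%E)) => [|i /andP[_ iN]]; last first.
    rewrite indicE mem_set//= in_itv /= -ler_norml; apply: le_trans uN _.
    by rewrite ler_pM2l// lef_pV2 ?posrE// ler_nat leq_exp2l.
  by rewrite sumEFin lee_fin big_const_nat subn0 iter_addr addr0.
have S0 : 0 <= S by apply: nneseries_ge0 => i _ _; rewrite lee_fin.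
have [uE|u0] := eqVneq u 0%R.
  rewrite /kap uE eqxx; suff -> : S = +oo by rewrite gt0_muley.
  apply/eqyP => A A0; have AN := archi_boundP (ltW A0).
  apply: (@le_trans _ _ (Num.bound A).+1%:R%:E).
    by rewrite lee_fin (le_trans (ltW AN))// ler_nat.
  by apply: ind; rewrite uE normr0 divr_ge0// ltW.
have u00 : (0 < `|u|)%R by rewrite normr_gt0.
have [uC|uC] := leP `|u|%R C; last first.
  rewrite /kap (negPf u0) max_r; last by rewrite subr_le0 ler_ln ?posrE// ltW.
  by rewrite mule_ge0// lee_fin ltW.
have ex : exists N, (C / (2 ^ N)%:R < `|u|)%R.
  exists (Num.bound (C / `|u|)); rewrite ltr_pdivrMr// mulrC -ltr_pdivrMr//.
  apply: lt_trans (archi_boundP _) _; first by rewrite divr_ge0// ltW.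
  by rewrite ltr_nat ltn_expl.
case: (ex_minnP ex) => [[|N]]; first by rewrite expn0 divr1 ltNge uC.
move=> uN /(_ N) minN; have {minN}uN' : (`|u| <= C / (2 ^ N)%:R)%R.
  by rewrite leNgt; apply/negP => /minN; rewrite ltnn.
apply: (@le_trans _ _ ((ln 2)%:E * N.+1%:R%:E)); last first.
  by rewrite lee_pmul2l ?lte_fin//; exact: ind.
rewrite kapE// -EFinM lee_fin lerBlDr mulr_natr -lnXn ?ltr0n// -lnM ?posrE ?exprn_gt0//.
rewrite ler_ln ?posrE ?mulr_gt0 ?exprn_gt0//.
by move: uN; rewrite ltr_pdivrMr// natrX mulrC => /ltW.
Qed.

Lemma integral_kap C x : (0 < C)%R ->
  \int[lebesgue_measure]_t kap C (x - t) <= (ln 2 * (4 * C))%:E.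
Proof.
move=> C0; have ln2 : (0 < ln 2 :> R)%R by rewrite ln_gt0// ltr1n.
have pw i : (0 < (2 ^ i)%:R :> R)%R by rewrite ltr0n expn_gt0.
pose I i : set R := `[(x - C / (2 ^ i)%:R)%R, (x + C / (2 ^ i)%:R)%R]%classic.
have mkap : measurable_fun [set: measurableTypeR R] (fun t => kap C (x - t)).
  by apply: (measurableT_comp (measurable_kap C)); exact: measurable_funB.
have mI i : measurable_fun [set: measurableTypeR R] (fun t => (\1_(I i) t : R)%:E).
  by apply/measurable_EFinP; apply: measurable_indic; exact: measurable_itv.
have mS : measurable_fun [set: measurableTypeR R]
    (fun t => \sum_(0 <= i <oo) (\1_(I i) t : R)%:E).
  by apply: (@ge0_emeasurable_sum _ _ _ _ _ xpredT) => // i t _ _; rewrite lee_fin.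
apply: (@le_trans _ _ (\int[lebesgue_measure]_t
    ((ln 2)%:E * \sum_(0 <= i <oo) (\1_(I i) t : R)%:E))).
  apply: ge0_le_integral => //.
  - by move=> t _; exact: kap_ge0.
  - exact: measurable_funeM.
  move=> t _; have := kap_dyadic (x - t) C0.
  rewrite (eq_eseriesr (g := fun i => (\1_(I i) t : R)%:E))// => i _.
  rewrite !indicE /I; set r := (C / _)%R; clearbody r;
  congr ((nat_of_bool _)%:R%:E); apply/idP/idP => /set_mem /=;
    rewrite ?in_itv /= => /andP[h1 h2]; apply/mem_set; rewrite /= ?in_itv /=;
    apply/andP; split; lra.
rewrite ge0_integralZl//; last 2 first.
- by move=> t _; apply: nneseries_ge0 => i _ _; rewrite lee_fin.
- by rewrite lee_fin ltW.
rewrite EFinM lee_pmul2l ?lte_fin// integral_nneseries//.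
have C4 : (0 <= 4 * C)%R by rewrite mulr_ge0// ltW.
(* With the zero sequence this is the geometric series: its terms 4C / 2^(i+1) are the lengths of
   the intervals [I i]. *)
have := @epsilon_trick R (fun=> 0%E) (4 * C)%R xpredT (fun=> lexx _) C4.
rewrite [X in _ <= X + _]eseries0// add0e; apply: le_trans.
apply: lee_nneseries => [i _ _|i _].
  by apply: integral_ge0 => t _; rewrite lee_fin.
rewrite integral_indic//= ?setIT; last exact: measurable_itv.
rewrite add0e lebesgue_measure_itv /= lte_fin.
case: ifPn => _; last by rewrite lee_fin divr_ge0// mulr_ge0// ltW.
rewrite -EFinB lee_fin expnS natrM; rewrite le_eqVlt; apply/orP; left; apply/eqP; field.
by rewrite pnatr_eq0 expn_eq0.
Qed.

End LogKernel.

(** * Lipschitz images of null sets *)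

Section LipschitzImage.
Context {R : realType}.
Local Open Scope ereal_scope.
Let mu := @lebesgue_measure R.

(** [f] is controlled on [B] only, so the image is enclosed in an interval centred at f(x0) for some
    x0 of [B] in ]a, b[; this costs the factor 2. The image need not be measurable, and its measure
    is an outer measure. *)
Lemma lipschitz_image_itv (f : R -> R) (B : set R) (L a b : R) :
  (0 < L)%R ->
  (forall x y, B x -> B y -> `|f x - f y| <= L * `|x - y|)%R ->
  mu (f @` (B `&` `]a, b[)) <= (2 * L)%:E * wlength idfun `]a, b[%classic.
Proof.
move=> L0 fL; have [->|/set0P[x0 [Bx0]]] := eqVneq (B `&` `]a, b[) set0.
  by rewrite image_set0 /mu measure0 mule_ge0// ?lee_fin ?mulr_ge0 ?(ltW L0)// wlength_ge0.
rewrite /= in_itv /= => /andP[ax0 x0b].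
have ab := lt_trans ax0 x0b.
apply: (@le_trans _ _
    (mu `[(f x0 - L * (b - a))%R, (f x0 + L * (b - a))%R]%classic)).
  apply: le_outer_measure => _ [x [Bx +] <-].
  rewrite /= in_itv /= => /andP[ax xb].
  rewrite /= in_itv /= -ler_distl (le_trans (fL _ _ Bx Bx0))// ler_pM2l//.
  by rewrite ler_norml; apply/andP; split; lra.
rewrite /mu lebesgue_measure_itv /= wlength_itv /= !lte_fin ab.
case: ifPn => _; first by rewrite -!EFinD -EFinM lee_fin; lra.
by rewrite -EFinD -EFinM lee_fin mulr_ge0// ?mulr_ge0 ?subr_ge0 ?(ltW L0)// ltW.
Qed.

Lemma lipschitz_image_negligible (f : R -> R) (B : set R) (L : R) :
  (0 < L)%R ->
  (forall x y, B x -> B y -> `|f x - f y| <= L * `|x - y|)%R ->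
  mu.-negligible B -> mu.-negligible (f @` B).
Proof.
move=> L0 fL /negligible_outer_measure B0.
apply/negligible_outer_measure/eqP; rewrite eq_le outer_measure_ge0 andbT.
apply/lee_addgt0Pr => eps eps0; rewrite add0e.
have eL : (0 < eps / (2 * L))%R by rewrite divr_gt0// mulr_gt0.
move: B0; rewrite outer_measure_open_itv_cover => B0.
have /lb_ereal_inf_adherent : ereal_inf
    [set \sum_(0 <= k <oo) wlength idfun (F k) | F in open_itv_cover B]
    \is a fin_num by rewrite B0.
move=> /(_ _ eL)[_ [F [Fitv BF] <-]]; rewrite B0 add0e => Feps.
apply: (@le_trans _ _ (mu (\bigcup_k (f @` (B `&` F k))))).
  apply: le_outer_measure => _ [x Bx <-].
  by have [k _ Fkx] := BF _ Bx; exists k => //; exists x.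
apply: (le_trans (outer_measure_sigma_subadditive mu _)).
apply: (@le_trans _ _ (\sum_(0 <= k <oo) ((2 * L)%:E * wlength idfun (F k)))).
  apply: lee_nneseries => [k _ _|k _]; first exact: outer_measure_ge0.
  by case: (Fitv k) => -[a b] /= ->; exact: lipschitz_image_itv.
rewrite nneseriesZl; last by move=> k _; exact: wlength_ge0.
rewrite -lee_pdivlMl ?mulr_gt0//.
by rewrite -EFinM mulrC (le_trans (ltW Feps)).
Qed.

End LipschitzImage.

(** * Potentials and the energy problem *)

Section LogPotential.
Context {R : realType}.
Implicit Types (C : R) (e : set R) (mu nu rho : probability (measurableTypeR R) R).
Local Open Scope ereal_scope.

Lemma supported_ae_eq_integral e mu (f g : R -> \bar R) :
  measurable e -> supported_on e mu ->
  measurable_fun [set: measurableTypeR R] f -> measurable_fun [set: measurableTypeR R] g ->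
  (forall t, e t -> f t = g t) -> \int[mu]_t f t = \int[mu]_t g t.
Proof.
move=> me mue mf mg fg; apply: ae_eq_integral => //.
exists (~` e); split => //; first exact: measurableC.
by move=> t /= nfg et; apply: nfg => _; exact: fg.
Qed.

Lemma supported_le_integral e mu (f g : R -> \bar R) :
  measurable e -> supported_on e mu ->
  measurable_fun [set: measurableTypeR R] f -> measurable_fun [set: measurableTypeR R] g ->
  (forall t, 0 <= f t) -> (forall t, 0 <= g t) ->
  (forall t, e t -> f t <= g t) -> \int[mu]_t f t <= \int[mu]_t g t.
Proof.
move=> me mue mf mg f0 g0 fg; apply: ae_ge0_le_integral => //.
exists (~` e); split => //; first exact: measurableC.
by move=> t /= nfg et; apply: nfg => _; exact: fg.
Qed.

Lemma integral_prob_cst mu (c : R) : \int[mu]_t c%:E = c%:E.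
Proof.
rewrite integral_cst// -[RHS]mule1; congr (_ * _).
exact: probability_setT.
Qed.

(** The integral of [f] may be +oo. With g = f - c, whose negative part is at most c, the identity
    g^+ + c = f + g^- has nonnegative terms only and can be integrated. *)
Lemma integral_subr_cst mu (f : R -> \bar R) (c : R) :
  measurable_fun [set: measurableTypeR R] f -> (forall t, 0 <= f t) -> (0 <= c)%R ->
  \int[mu]_t (f t - c%:E) = \int[mu]_t f t - c%:E.
Proof.
move=> mf f0 c0; pose g t := f t - c%:E.
have mg : measurable_fun [set: measurableTypeR R] g by apply: emeasurable_funB.
have gn t : g^\- t <= c%:E.
  rewrite funenegE /g ge_max lee_fin c0 andbT leeNl -[leLHS]add0e.
  by apply: leeD.
have mgp : measurable_fun [set: measurableTypeR R] g^\+ by exact: measurable_funepos.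
have mgn : measurable_fun [set: measurableTypeR R] g^\- by exact: measurable_funeneg.
have intn : \int[mu]_t g^\- t <= c%:E.
  apply: (@le_trans _ _ (\int[mu]_t cst c%:E t)).
    by apply: ge0_le_integral => //; move=> t _; exact: gn.
  by rewrite integral_prob_cst.
have intn0 : 0 <= \int[mu]_t g^\- t by apply: integral_ge0.
have intnfin : \int[mu]_t g^\- t \is a fin_num.
  by rewrite ge0_fin_numE// (le_lt_trans intn) ?ltry.
rewrite -[LHS]/(\int[mu]_t g t) integralE.
have : \int[mu]_t (g^\+ t + c%:E) = \int[mu]_t (f t + g^\- t).
  apply: eq_integral => t _; have gt : g t = g^\+ t - g^\- t by rewrite {1}[g]funeposneg.
  have gtn : g^\- t \is a fin_num.
    by rewrite ge0_fin_numE// (le_lt_trans (gn t)) ?ltry.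
  have -> : f t = g t + c%:E by rewrite /g subeK.
  by rewrite gt addeAC subeK.
rewrite !ge0_integralD//.
rewrite integral_prob_cst => E.
by rewrite -(@addeK _ c%:E (\int[mu]_t g^\+ t))// E addeAC addeK.
Qed.

(** By [potentialE] this is the potential plus log C at every x whose distance to each point of the
    supporting set is at most C. *)
Definition logpot C mu x : \bar R := \int[mu]_t kap C (x - t).

Lemma measurable_kapB C (x : R) : measurable_fun [set: measurableTypeR R] (fun t => kap C (x - t)).
Proof. by apply: (measurableT_comp (measurable_kap C)); exact: measurable_funB. Qed.

Lemma measurable_kap2 C :
  measurable_fun [set: measurableTypeR R * measurableTypeR R]
    (fun p : measurableTypeR R * measurableTypeR R => kap C (p.1 - p.2)).
Proof.
apply: (measurableT_comp (measurable_kap C)).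
by apply: measurable_funB; [exact: measurable_fst|exact: measurable_snd].
Qed.

Lemma measurable_logpot C mu : measurable_fun [set: measurableTypeR R] (logpot C mu).
Proof.
apply: (measurable_fun_fubini_tonelli_F (m2 := mu)
  (fun p : measurableTypeR R * measurableTypeR R => kap C (p.1 - p.2))).
  exact: measurable_kap2.
by move=> p; exact: kap_ge0.
Qed.

Lemma logpot_ge0 C mu x : 0 <= logpot C mu x.
Proof. by apply: integral_ge0 => t _; exact: kap_ge0. Qed.

Lemma log_kernel_real (x t : R) : log_kernel x%:C t%:C =
  if (x - t == 0)%R then +oo else (- ln `|x - t|)%:E.
Proof.
rewrite /log_kernel -rmorphB normc_real.
have [->|xt0] := eqVneq; first by rewrite normr0 /= lexx.
by rewrite lne_EFin ?normr_gt0.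
Qed.

Lemma measurable_log_kernel :
  measurable_fun [set: measurableTypeR R * measurableTypeR R]
    (fun p => log_kernel p.1%:C p.2%:C).
Proof.
have mB : measurable_fun [set: measurableTypeR R * measurableTypeR R]
    (fun p => p.1 - p.2)%R.
  by apply: measurable_funB; [exact: measurable_fst|exact: measurable_snd].
under eq_fun do rewrite log_kernel_real.
apply: measurable_fun_ifT => //=; first exact: measurable_fun_eqr.
apply/measurable_EFinP; apply: measurable_funN.
apply: (measurableT_comp (@measurable_ln R)).
by apply: measurableT_comp mB; exact: normr_measurable.
Qed.

Lemma measurable_potential mu :
  measurable_fun [set: measurableTypeR R] (fun x => potential mu x%:C).
Proof.
pose f (p : measurableTypeR R * measurableTypeR R) := log_kernel p.1%:C p.2%:C.
have -> : (fun x => potential mu x%:C) =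
    (fun x => \int[mu]_t f^\+ (x, t) - \int[mu]_t f^\- (x, t)).
  apply/funext => x; rewrite /potential integralE; congr (_ - _).
    by apply: eq_integral => t _; rewrite !funeposE.
  by apply: eq_integral => t _; rewrite !funenegE.
apply: emeasurable_funB.
- apply: (measurable_fun_fubini_tonelli_F (m2 := mu) f^\+) => //.
  exact: measurable_funepos measurable_log_kernel.
- apply: (measurable_fun_fubini_tonelli_F (m2 := mu) f^\-) => //.
  exact: measurable_funeneg measurable_log_kernel.
Qed.

Lemma potentialE C e mu x : measurable e -> supported_on e mu -> (1 <= C)%R ->
  (forall t, e t -> `|x - t| <= C)%R ->
  potential mu x%:C = logpot C mu x - (ln C)%:E.
Proof.
move=> me mue C1 xC; rewrite /potential.
rewrite -integral_subr_cst; last 3 first.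
- exact: measurable_kapB.
- by move=> t; exact: kap_ge0.
- by rewrite ln_ge0.
apply: (supported_ae_eq_integral me mue).
- exact: (measurable_fun_pair2 x measurable_log_kernel).
- by apply: emeasurable_funB => //; exact: measurable_kapB.
- by move=> t et; apply: log_kernelE; [exact: lt_le_trans ltr01 C1|exact: xC].
Qed.

Lemma energyE C e mu : measurable e -> supported_on e mu -> (1 <= C)%R ->
  (forall x t, e x -> e t -> `|x - t| <= C)%R ->
  energy mu = \int[mu]_x logpot C mu x - (ln C)%:E.
Proof.
move=> me mue C1 eC; rewrite /energy.
rewrite -integral_subr_cst; last 3 first.
- exact: measurable_logpot.
- by move=> t; exact: logpot_ge0.
- by rewrite ln_ge0.
apply: (supported_ae_eq_integral me mue).
- exact: measurable_potential.
- by apply: emeasurable_funB => //; exact: measurable_logpot.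
- by move=> x ex; apply: (potentialE me) => // t et; exact: eC.
Qed.

Lemma logpot_sym C mu nu :
  \int[mu]_x logpot C nu x = \int[nu]_x logpot C mu x.
Proof.
rewrite /logpot
  (fubini_tonelli (fun p : measurableTypeR R * measurableTypeR R => kap C (p.1 - p.2)))/=.
- by apply: eq_integral => x _; apply: eq_integral => t _; rewrite -kapN opprB.
- exact: measurable_kap2.
- by move=> p; exact: kap_ge0.
Qed.

End LogPotential.

(** * Frostman's variational inequality *)

Section Frostman.
Context {R : realType}.
Implicit Types (C : R) (e B : set R) (mu nu rho xi : probability (measurableTypeR R) R).
Local Open Scope ereal_scope.

(** [mnormalize] serves only to package a measure of mass 1 as a [probability]. *)
Lemma mnormalize_mass1 d (T : measurableType d) (m : {measure set T -> \bar R})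
  (P : probability T R) A : m setT = 1 -> mnormalize m P A = m A.
Proof. by move=> m1; rewrite /mnormalize m1 onee_eq0 /= invr1 mule1. Qed.

Lemma probability_mixture mu nu (s t : R) : (0 <= s)%R -> (0 <= t)%R ->
  (s + t = 1)%R ->
  exists2 xi : probability (measurableTypeR R) R,
    (forall A, xi A = s%:E * mu A + t%:E * nu A) &
    forall f : R -> \bar R, measurable_fun [set: measurableTypeR R] f ->
      (forall x, 0 <= f x) ->
      \int[xi]_x f x = s%:E * \int[mu]_x f x + t%:E * \int[nu]_x f x.
Proof.
move=> s0 t0 st1; pose m := measure_add (mscale (NngNum s0) mu) (mscale (NngNum t0) nu).
have mE A : m A = s%:E * mu A + t%:E * nu A by rewrite /m measure_addE.
have m1 : m setT = 1.
  rewrite mE; transitivity (s%:E * 1 + t%:E * 1).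
    by congr (_ * _ + _ * _); exact: probability_setT.
  by rewrite !mule1 -EFinD st1.
have mm A : mnormalize m mu A = m A.
  exact: mnormalize_mass1.
exists (mnormalize m mu) => [A|f mf f0]; first by rewrite -mE; exact: mm.
rewrite (eq_measure_integral m) => [|A _ _]; last exact: mm.
rewrite ge0_integral_measure_add//.
by rewrite !ge0_integral_mscale.
Qed.

Lemma probability_uniform_on B : measurable (B : set (measurableTypeR R)) ->
  0 < lebesgue_measure B -> lebesgue_measure B < +oo ->
  exists2 xi : probability (measurableTypeR R) R, xi (~` B) = 0 &
    forall f : R -> \bar R, measurable_fun [set: measurableTypeR R] f ->
      (forall x, 0 <= f x) ->
      \int[xi]_x f x =
        ((fine (lebesgue_measure B))^-1)%:E * \int[lebesgue_measure]_(x in B) f x.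
Proof.
move=> mB B0 Boo; set b := fine _.
have bE : lebesgue_measure B = b%:E by rewrite fineK// ge0_fin_numE.
have b0 : (0 < b)%R by rewrite -lte_fin -bE.
have bV0 : (0 <= b^-1)%R by rewrite invr_ge0 ltW.
pose m := mscale (NngNum bV0) (mrestr (@lebesgue_measure R) mB).
have mE A : m A = b^-1%:E * lebesgue_measure (A `&` B) by [].
have m1 : m setT = 1.
  by rewrite mE setTI bE -EFinM mulVf// gt_eqF.
pose P0 : probability (measurableTypeR R) R :=
  @dirac _ (measurableTypeR R) (0%R : R) R.
have mm A : mnormalize m P0 A = m A.
  exact: mnormalize_mass1.
exists (mnormalize m P0) => [|f mf f0].
  by transitivity (m (~` B)); [exact: mm|rewrite mE setICl measure0 mule0].
rewrite (eq_measure_integral m) => [|A _ _]; last exact: mm.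
rewrite ge0_integral_mscale//; congr (_ * _).
have mBC : measurable (~` B : set (measurableTypeR R)) by exact: measurableC.
have B0' : mrestr (@lebesgue_measure R) mB (~` B) = 0.
  by rewrite /mrestr/= setICl measure0.
apply: etrans (ge0_negligible_integral mBC measurableT mf (fun x _ => f0 x) B0') _.
rewrite setDE setTI setCK; apply: eq_measure_integral => A mA AB.
by congr (lebesgue_measure _); exact: setIidl.
Qed.

Lemma le_robin_logpot C e mu : measurable e -> (1 <= C)%R ->
  (forall x t, e x -> e t -> `|x - t| <= C)%R ->
  supported_on e mu -> robin e + (ln C)%:E <= \int[mu]_x logpot C mu x.
Proof.
move=> me C1 eC mue; rewrite -leeBrDr// -(energyE me)//.
by apply: ereal_inf_lbound; exists mu.
Qed.

Lemma equilibrium_logpot C e rho : measurable e -> (1 <= C)%R ->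
  (forall x t, e x -> e t -> `|x - t| <= C)%R ->
  is_equilibrium e rho -> \int[rho]_x logpot C rho x = robin e + (ln C)%:E.
Proof.
move=> me C1 eC [rhoe <-]; rewrite (energyE me rhoe C1 eC) subeK//.
Qed.

(** The energy is a quadratic form in the measure; its two cross terms agree by Tonelli. *)
Lemma integralD_logpot C mu nu xi (s t : R) : (0 <= s)%R -> (0 <= t)%R ->
  (forall f : R -> \bar R, measurable_fun [set: measurableTypeR R] f ->
      (forall x, 0 <= f x) ->
      \int[xi]_x f x = s%:E * \int[mu]_x f x + t%:E * \int[nu]_x f x) ->
  \int[xi]_x logpot C xi x =
    (s ^+ 2)%:E * \int[mu]_x logpot C mu x +
    (2 * s * t)%:E * \int[nu]_x logpot C mu x +
    (t ^+ 2)%:E * \int[nu]_x logpot C nu x.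
Proof.
move=> s0 t0 xiE.
have logE x : logpot C xi x = s%:E * logpot C mu x + t%:E * logpot C nu x.
  by rewrite /logpot xiE => [//||t']; [exact: measurable_kapB|exact: kap_ge0].
under eq_integral do rewrite logE.
have m1 (k : R) mu' : measurable_fun [set: measurableTypeR R]
    (fun x => k%:E * logpot C mu' x).
  by apply: measurable_funeM; exact: measurable_logpot.
have p1 (k : R) mu' x : (0 <= k)%R -> 0 <= k%:E * logpot C mu' x.
  by move=> k0; rewrite mule_ge0 ?lee_fin// logpot_ge0.
rewrite ge0_integralD//; [|by move=> x _; exact: p1..].
have z mu' (k : R) : (0 <= k)%R -> \int[xi]_x (k%:E * logpot C mu' x) =
    k%:E * (s%:E * \int[mu]_x logpot C mu' x + t%:E * \int[nu]_x logpot C mu' x).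
  move=> k0; rewrite ge0_integralZl//; last 2 first.
  - exact: measurable_logpot.
  - by move=> x _; exact: logpot_ge0.
  - by rewrite xiE//; [exact: measurable_logpot|move=> x; exact: logpot_ge0].
rewrite !z// (logpot_sym C mu nu).
have i0 mu' nu' : 0 <= \int[mu']_x logpot C nu' x.
  by apply: integral_ge0 => x _; exact: logpot_ge0.
move: (i0 mu mu) (i0 nu mu) (i0 nu nu).
move: (\int[mu]_x logpot C mu x) (\int[nu]_x logpot C mu x)
  (\int[nu]_x logpot C nu x) => p q r p0 q0 r0.
rewrite !ge0_muleDr ?mule_ge0 ?lee_fin//.
rewrite !muleA -!EFinM -!expr2 -!addeA; congr (_ + _).
rewrite addeA; congr (_ + _).
by rewrite -ge0_muleDl ?lee_fin ?mulr_ge0// -EFinD; congr (_%:E * _); ring.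
Qed.

(** The energy of (1 - t) rho + t nu is i + 2t(j - i) + t^2 (i - 2j + l), with i, l the energies of
    rho, nu and j the mixed one. It is at least i; dividing by t and taking t small gives i <= j. *)
Lemma frostman C e rho nu (rr : R) : measurable e -> (1 <= C)%R ->
  (forall x t, e x -> e t -> `|x - t| <= C)%R ->
  is_equilibrium e rho -> robin e = rr%:E ->
  supported_on e nu -> \int[nu]_x logpot C nu x < +oo ->
  (rr + ln C)%:E <= \int[nu]_x logpot C rho x.
Proof.
move=> me C1 eC req rrE nue nufin.
have i0 mu' nu' : 0 <= \int[mu']_x logpot C nu' x.
  by apply: integral_ge0 => x _; exact: logpot_ge0.
have := equilibrium_logpot me C1 eC req; rewrite rrE -EFinD => rhoE.
have [<-|] := eqVneq +oo (\int[nu]_x logpot C rho x); first by rewrite leey.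
rewrite eq_sym => joo.
have [j jE] : exists j : R, \int[nu]_x logpot C rho x = j%:E.
  by exists (fine (\int[nu]_x logpot C rho x)); rewrite fineK// ge0_fin_numE// ltey.
have [l lE] : exists l : R, \int[nu]_x logpot C nu x = l%:E.
  by exists (fine (\int[nu]_x logpot C nu x)); rewrite fineK// ge0_fin_numE// ltey.
rewrite jE lee_fin; set i := (rr + ln C)%R in rhoE *.
have var t : (0 < t <= 1)%R -> (0 <= 2 * (j - i) + t * (i - 2 * j + l))%R.
  move=> /andP[t0 t1].
  have s0 : (0 <= 1 - t)%R by rewrite subr_ge0.
  have st : (1 - t + t = 1)%R by ring.
  have [xi xiA xiE] := probability_mixture rho nu s0 (ltW t0) st.
  have xie : supported_on e xi.
    rewrite /supported_on xiA; case: req => -> _.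
    by rewrite (nue : nu _ = 0) !mule0 adde0.
  have := le_robin_logpot me C1 eC xie; rewrite rrE -EFinD (integralD_logpot C s0 (ltW t0) xiE).
  rewrite rhoE jE lE -!EFinM -!EFinD lee_fin -/i => h.
  rewrite -(pmulr_rge0 _ t0).
  apply: le_trans (_ : 0 <= ((1 - t) ^+ 2 * i + 2 * (1 - t) * t * j + t ^+ 2 * l) - i)%R _.
    by rewrite subr_ge0.
  by rewrite le_eqVlt; apply/orP; left; apply/eqP; ring.
rewrite leNgt; apply/negP => ji.
set k := (i - 2 * j + l)%R in var.
have [k0|k0] := leP k 0%R.
  by have := var 1%R; rewrite ltr01 lexx mul1r => /(_ isT); lra.
(* This replaces the limit t -> 0: since t k <= i - j, the quantity 2(j - i) + t k is at most j - i
   < 0. *)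
pose t := Num.min 1%R ((i - j) / k)%R.
have t0 : (0 < t)%R by rewrite lt_min ltr01 divr_gt0// subr_gt0.
have t1 : (t <= 1)%R by rewrite ge_min lexx.
have tk : (t * k <= i - j)%R by rewrite -ler_pdivlMr// ge_min lexx orbT.
by have := var t; rewrite t0 t1 => /(_ isT); lra.
Qed.

End Frostman.

Section LowPotential.
Context {R : realType}.
Implicit Types (C : R) (e B : set R) (mu nu rho : probability (measurableTypeR R) R).
Local Open Scope ereal_scope.

(** Normalised Lebesgue measure on [B] has bounded density, so [integral_kap] bounds its potential
    everywhere. *)
Lemma uniform_finite_energy C B : (0 < C)%R ->
  measurable (B : set (measurableTypeR R)) ->
  0 < lebesgue_measure B -> lebesgue_measure B < +oo ->
  exists2 nu, supported_on B nu & \int[nu]_x logpot C nu x < +oo.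
Proof.
move=> C0 mB B0 Boo; have [nu nuB nuE] := probability_uniform_on mB B0 Boo.
exists nu => //; move: nuE; set b := (fine _)^-1%R => nuE.
have b0 : (0 <= b)%R by rewrite invr_ge0 fine_ge0.
have le_log x : logpot C nu x <= (b * (ln 2 * (4 * C)))%:E.
  rewrite /logpot nuE; last 2 first.
  - exact: measurable_kapB.
  - by move=> t; exact: kap_ge0.
  rewrite EFinM lee_wpmul2l//; apply: le_trans (integral_kap x C0).
  apply: ge0_subset_integral => //; first exact: measurable_kapB.
  by move=> t _; exact: kap_ge0.
apply: (@le_lt_trans _ _ (\int[nu]_x (b * (ln 2 * (4 * C)))%:E)); last first.
  by rewrite integral_prob_cst ltry.
apply: ge0_le_integral => //.
- by move=> x _; exact: logpot_ge0.
- exact: measurable_logpot.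
Qed.

(** Suppose the potential were below its level by 1/(m+1) on a set of positive measure. The uniform
    measure on that set has finite energy and contradicts [frostman]. *)
Lemma low_potential_negligible C e rho (rr : R) :
  measurable (e : set (measurableTypeR R)) -> lebesgue_measure e < +oo ->
  (1 <= C)%R -> (forall x t, e x -> e t -> `|x - t| <= C)%R ->
  is_equilibrium e rho -> robin e = rr%:E ->
  lebesgue_measure.-negligible
    [set x | e x /\ logpot C rho x < (rr + ln C)%:E].
Proof.
move=> me eoo C1 eC req rrE.
have C0 : (0 < C)%R by exact: lt_le_trans ltr01 C1.
pose B (m : nat) : set (measurableTypeR R) :=
  e `&` [set x | logpot C rho x <= (rr + ln C - m.+1%:R^-1)%:E].
have mB m : measurable (B m).
  apply: emeasurable_fun_infty_c => //.
  by apply: measurable_funTS; exact: measurable_logpot.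
suff B0 m : lebesgue_measure (B m) = 0.
  apply: (@negligibleS _ _ _ _ (\bigcup_m B m)).
    move=> x [ex lx].
    have [k kP] : exists k : R, logpot C rho x = k%:E.
      exists (fine (logpot C rho x)); rewrite fineK// ge0_fin_numE ?logpot_ge0//.
      by rewrite (lt_trans lx) ?ltry.
    move: lx; rewrite kP lte_fin -subr_gt0 => lx.
    have [m _ /(_ m (leqnn _)) hm] := near_infty_natSinv_lt (PosNum lx).
    exists m => //; split => //=; rewrite kP lee_fin.
    have {}hm : (m.+1%:R^-1 < rr + ln C - k)%R by exact: hm.
    by rewrite lerBrDl addrC -lerBrDl; exact: ltW.
  apply: negligible_bigcup => m.
  by apply/negligibleP; [exact: mB|exact: B0].
apply/eqP; rewrite eq_le measure_ge0 andbT leNgt; apply/negP => Bm0.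
have Bmoo : lebesgue_measure (B m) < +oo.
  by apply: le_lt_trans eoo; apply: le_measure; rewrite ?inE// => x [].
have [nu nuB nufin] := uniform_finite_energy C0 (mB m) Bm0 Bmoo.
have mBC : measurable (~` (B m)) by exact: measurableC.
have nue : supported_on e nu.
  apply/eqP; rewrite eq_le measure_ge0 andbT -[leRHS]nuB.
  by apply: le_measure; rewrite ?inE//; [exact: measurableC|move=> x nex [/nex]].
have := frostman me C1 eC req rrE nue nufin; rewrite leNgt => /negP; apply.
(* The comparison of integrals asks for a nonnegative bound. As [B m] is nonempty and [logpot]
   nonnegative, the level itself is nonnegative. *)
apply: (@le_lt_trans _ _ (\int[nu]_x (Num.max 0 (rr + ln C - m.+1%:R^-1))%:E)).
  apply: (supported_le_integral (mB m) nuB) => //.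
  - exact: measurable_logpot.
  - by move=> t; exact: logpot_ge0.
  - by move=> t; rewrite lee_fin le_max lexx.
  - move=> t [_ /= /le_trans]; apply.
    by rewrite lee_fin le_max lexx orbT.
rewrite integral_prob_cst lte_fin gt_max; apply/andP; split; last first.
  by rewrite ltrBlDr ltrDl invr_gt0.
have Bne : B m !=set0.
  by apply/set0P/eqP => Be; move: Bm0; rewrite Be measure0 ltxx.
have [x [_ /=]] := Bne.
move=> /(le_trans (logpot_ge0 C rho x)); rewrite lee_fin subr_ge0 => h.
by apply: lt_le_trans h; rewrite invr_gt0.
Qed.

Lemma robin_gtNy C e : measurable (e : set (measurableTypeR R)) -> (1 <= C)%R ->
  (forall x t, e x -> e t -> `|x - t| <= C)%R -> -oo < robin e.
Proof.
move=> me C1 eC; apply: (@lt_le_trans _ _ (- (ln C))%:E); first by rewrite ltNyr.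
apply: le_ereal_inf_tmp => _ [mu mue <-].
rewrite (energyE me mue C1 eC) EFinN -[leLHS]add0e leeD//.
by apply: integral_ge0 => x _; exact: logpot_ge0.
Qed.

Lemma robin_lty C e : measurable (e : set (measurableTypeR R)) -> (1 <= C)%R ->
  (forall x t, e x -> e t -> `|x - t| <= C)%R ->
  0 < lebesgue_measure e -> lebesgue_measure e < +oo -> robin e < +oo.
Proof.
move=> me C1 eC e0 eoo; have C0 : (0 < C)%R by exact: lt_le_trans ltr01 C1.
have [nu nue nufin] := uniform_finite_energy C0 me e0 eoo.
apply: (@le_lt_trans _ _ (energy nu)).
  by apply: ereal_inf_lbound; exists nu.
rewrite (energyE me nue C1 eC); case: (\int[nu]_x _) nufin => //= r _.
by rewrite -EFinB ltry.
Qed.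

End LowPotential.

(** * The Green's function in a gap *)

Section LogExpansion.
Context {R : realType}.
Implicit Types (u d h : R).

(* With s = sqrt (1 + u), ln (1 + u) = 2 ln s <= 2 (s - 1) = u - (s - 1)^2
   and (s - 1)^2 = u^2 / (s + 1)^2 >= u^2 / (2 s^2 + 2). *)
Lemma ln1D_le_quadratic u : -1 < u -> ln (1 + u) <= u - u ^+ 2 / (4 + 2 * u).
Proof.
move=> u1; have u0 : 0 < 1 + u by lra.
pose s := Num.sqrt (1 + u); have s0 : 0 < s by rewrite sqrtr_gt0.
have sE : s ^+ 2 = 1 + u by rewrite sqr_sqrtr// ltW.
have -> : u = s ^+ 2 - 1 by lra.
rewrite addrC subrK lnXn//.
have h : ln s <= s - 1.
  by rewrite -{1}(subrK 1 s) addrC le_ln1Dx//; lra.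
have -> : 4 + 2 * (s ^+ 2 - 1) = 2 * (s ^+ 2 + 1) by ring.
apply: (@le_trans _ _ ((s - 1) *+ 2)); first by rewrite lerMn2r h orbT.
rewrite -subr_ge0.
have -> : s ^+ 2 - 1 - (s ^+ 2 - 1) ^+ 2 / (2 * (s ^+ 2 + 1)) - (s - 1) *+ 2
    = (s - 1) ^+ 2 * ((s - 1) ^+ 2 / (2 * (s ^+ 2 + 1))).
  by field; rewrite gt_eqF// ltr_wpDl ?sqr_ge0.
by rewrite mulr_ge0 ?sqr_ge0// divr_ge0 ?sqr_ge0// mulr_ge0// addr_ge0// sqr_ge0.
Qed.

(** The upper bound ln (1 + v) <= v at v = - u / (1 + u) gives ln (1 + u) >= u / (1 + u). *)
Lemma ln1D_ge_quadratic u : - 2^-1 <= u -> u - 2 * u ^+ 2 <= ln (1 + u).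
Proof.
move=> u1; have u0 : 0 < 1 + u by lra.
have h : ln (1 + - (u / (1 + u))) <= - (u / (1 + u)).
  by apply: le_ln1Dx; rewrite ltrN2 ltr_pdivrMr//; lra.
have E : 1 + - (u / (1 + u)) = (1 + u)^-1 by field; rewrite gt_eqF.
move: h; rewrite E lnV ?posrE// lerN2; apply: le_trans.
rewrite -subr_ge0.
have -> : u / (1 + u) - (u - 2 * u ^+ 2) = u ^+ 2 * (1 + 2 * u) / (1 + u).
  by field; rewrite gt_eqF.
by rewrite divr_ge0 ?(ltW u0)// mulr_ge0 ?sqr_ge0//; lra.
Qed.

(** Second-order expansion of log |d + h1 + i h2|, with linear term Re (h / d). The error depends on
    d through d0 only, so with d = w - t it can be integrated over t. The bound d0 / 8 keeps u = |1
    + h / d|^2 - 1 above -1/2. *)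
Lemma ln_norm_expansion (d0 d h1 h2 : R) : 0 < d0 -> d0 <= `|d| ->
  `|h1| <= d0 / 8 -> `|h2| <= d0 / 8 ->
  0 < (d + h1) ^+ 2 + h2 ^+ 2 /\
  `|2^-1 * ln ((d + h1) ^+ 2 + h2 ^+ 2) - ln `|d| - h1 / d| <=
    20 / d0 ^+ 2 * (h1 ^+ 2 + h2 ^+ 2).
Proof.
move=> d00 d0d h1d h2d.
have d0' : 0 < `|d| by apply: lt_le_trans d0d.
have dn0 : d != 0 by rewrite -normr_gt0.
pose x := h1 / d; pose y := h2 / d.
have xle : `|x| <= 8^-1.
  rewrite normrM normfV ler_pdivrMr//; apply: le_trans h1d _.
  by rewrite mulrC ler_pM2l// invr_gt0.
have yle : `|y| <= 8^-1.
  rewrite normrM normfV ler_pdivrMr//; apply: le_trans h2d _.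
  by rewrite mulrC ler_pM2l// invr_gt0.
pose u := 2 * x + (x ^+ 2 + y ^+ 2).
have x2 : x ^+ 2 <= 64^-1.
  by rewrite -real_normK ?num_real//; move: xle (normr_ge0 x); nra.
have y2 : y ^+ 2 <= 64^-1.
  by rewrite -real_normK ?num_real//; move: yle (normr_ge0 y); nra.
have [xl xr] : - 8^-1 <= x /\ x <= 8^-1 by move: xle; rewrite ler_norml => /andP.
have x20 : 0 <= x ^+ 2 by rewrite sqr_ge0.
have y20 : 0 <= y ^+ 2 by rewrite sqr_ge0.
have u1 : - 2^-1 <= u by rewrite /u; lra.
have E : (d + h1) ^+ 2 + h2 ^+ 2 = `|d| ^+ 2 * (1 + u).
  by rewrite real_normK ?num_real// /u /x /y; field.
have u0 : 0 < 1 + u by lra.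
split; first by rewrite E mulr_gt0// exprn_gt0.
rewrite E lnM ?posrE ?exprn_gt0// lnXn//.
have -> : 2^-1 * (ln `|d| *+ 2 + ln (1 + u)) - ln `|d| - h1 / d =
    2^-1 * ln (1 + u) - x by rewrite -/x; field.
have ub : ln (1 + u) <= u by apply: le_ln1Dx; lra.
have lb := ln1D_ge_quadratic u1.
have u2 : u ^+ 2 <= 9 * (x ^+ 2 + y ^+ 2).
  have -> : u ^+ 2 = 4 * x ^+ 2 + 4 * x * (x ^+ 2 + y ^+ 2) + (x ^+ 2 + y ^+ 2) ^+ 2.
    by rewrite /u; ring.
  have s0 : 0 <= x ^+ 2 + y ^+ 2 by rewrite addr_ge0.
  have s1 : x ^+ 2 + y ^+ 2 <= 1 by lra.
  have : 4 * x * (x ^+ 2 + y ^+ 2) <= 4 * (x ^+ 2 + y ^+ 2).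
    by rewrite ler_wpM2r//; lra.
  have : (x ^+ 2 + y ^+ 2) ^+ 2 <= x ^+ 2 + y ^+ 2.
    by rewrite expr2 ler_piMl.
  lra.
have sxy : x ^+ 2 + y ^+ 2 <= (h1 ^+ 2 + h2 ^+ 2) / d0 ^+ 2.
  have -> : x ^+ 2 + y ^+ 2 = (h1 ^+ 2 + h2 ^+ 2) / `|d| ^+ 2.
    by rewrite real_normK ?num_real// /x /y; field.
  rewrite ler_wpM2l ?addr_ge0 ?sqr_ge0// lef_pV2 ?posrE ?exprn_gt0//.
  by rewrite lerXn2r// nnegrE ltW.
apply: (@le_trans _ _ (20 * (x ^+ 2 + y ^+ 2))).
  by rewrite ler_norml; apply/andP; rewrite /u in ub lb u2 *; split; lra.
by rewrite mulrAC -mulrA ler_pM2l.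
Qed.

End LogExpansion.

(** * Lower semicontinuity of the potential *)

Section LogpotSemicontinuity.
Context {R : realType}.
Implicit Types (C : R) (e : set R) (mu : probability (measurableTypeR R) R).
Local Open Scope ereal_scope.

Lemma kap_cvg C (u_ : R^nat) u : u_ @ \oo --> u ->
  (kap C (u_ n) @[n --> \oo] --> kap C u).
Proof.
move=> uu; have uu' : (`|u_ n|%R @[n --> \oo] --> `|u|%R) by exact: cvg_norm.
have [u0|u0] := eqVneq u 0%R.
  rewrite {2}/kap u0 eqxx; apply/cvgeyPge => A.
  have e0 : (0 < expR (ln C - A))%R by exact: expR_gt0.
  have : \forall n \near \oo, (`|u_ n| < expR (ln C - A))%R.
    by apply: (cvgr_lt _ uu'); rewrite u0 normr0.
  apply: filterS => n un; rewrite /kap; case: eqVneq => [_|un0]; first by rewrite leey.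
  rewrite lee_fin le_max; apply/orP; left.
  rewrite lerBrDr -lerBrDl ; apply: ltW.
  by rewrite -ltr_expR lnK ?posrE ?normr_gt0.
have un0 : \forall n \near \oo, (0 < `|u_ n|)%R.
  by apply: (cvgr_gt _ uu'); rewrite normr_gt0.
rewrite {2}/kap (negPf u0).
apply: (@cvg_trans _ ((Num.max (ln C - ln `|u_ n|)%R 0)%:E @[n --> \oo])).
  apply: near_eq_cvg; near=> n; rewrite /kap ifF//.
  by apply/negbTE; rewrite -normr_gt0; near: n.
apply: cvg_EFin; first by near=> n.
have cphi : {for u, continuous (fun v : R => Num.max (ln C - ln `|v|)%R 0%R : R^o)}.
  apply: (@continuous_max R R (fun v => ln C - ln `|v|)%R (cst 0%R)).
    apply: cvgB; first exact: cvg_cst.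
    apply: (@continuous_cvg _ _ _ (nbhs u) _ Num.norm (@ln R)).
      by apply: continuous_ln; rewrite normr_gt0.
    by apply: cvg_norm; exact: cvg_id.
  exact: cvg_cst.
exact: (cvg_comp _ _ uu cphi).
Unshelve. all: by end_near. Qed.

(** Fatou's lemma, the kernel being continuous with values in the extended reals. It carries bounds
    from inside a gap to its endpoints, where the kernel may be infinite. *)
Lemma logpot_le_lim C mu (x_ : R^nat) x (A : \bar R) : x_ @ \oo --> x ->
  (forall n, logpot C mu (x_ n) <= A) -> logpot C mu x <= A.
Proof.
move=> xx VA.
have kE t : limn_einf (fun n => kap C (x_ n - t)) = kap C (x - t).
  apply: (cvg_limn_einf_sup _).1; apply: kap_cvg.
  by apply: cvgB => //; exact: cvg_cst.
rewrite /logpot; under eq_integral do rewrite -kE.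
apply: le_trans (fatou _ _ _ _) _ => //.
- by move=> n; exact: measurable_kapB.
- by move=> n t _; exact: kap_ge0.
rewrite limn_einf_lim; apply: lime_le.
  exact: is_cvg_einfs.
apply: nearW => n; apply: le_trans (VA n).
by apply: ereal_inf_lbound; exists n => //=.
Qed.

End LogpotSemicontinuity.

(** * The potential inside a gap and its strict convexity *)

Section GapPotential.
Context {R : realType} (e : set R) (rho : probability (measurableTypeR R) R).
Context (C a b : R) (me : measurable (e : set (measurableTypeR R)))
  (rhoe : supported_on e rho) (C1 : 1 <= C)
  (eC : forall x t, a <= x <= b -> e t -> `|x - t| <= C)
  (gap : forall t, e t -> t <= a \/ b <= t).

Local Notation E f := (\int[rho]_(t in e) f t)%R.

Lemma supported_probability : rho e = 1%E.
Proof.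
have := probability_setC rho me; rewrite (rhoe : rho (~` e) = 0%E) => h.
have fe : rho e \is a fin_num by exact: fin_num_measure.
by move/esym/eqP: h; rewrite sube_eq// ?add0e => /eqP.
Qed.

Lemma bounded_integrable_on (f : R -> R) (K : R) :
  measurable_fun (e : set (measurableTypeR R)) f ->
  (forall t, e t -> `|f t| <= K) -> rho.-integrable e (EFin \o f).
Proof.
move=> mf fK; apply: measurable_bounded_integrable => //.
  by apply: (@le_lt_trans _ _ 1%E); [exact: probability_le1|exact: ltry].
exists K; split; first exact: num_real.
by move=> k Kk t et; exact: le_trans (fK t et) (ltW Kk).
Qed.

Lemma supported_integral (f : R -> \bar R) :
  measurable_fun [set: measurableTypeR R] f ->
  (\int[rho]_t f t = \int[rho]_(t in e) f t)%E.
Proof.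
move=> mf; rewrite [RHS]integral_mkcond.
apply: (supported_ae_eq_integral me rhoe) => //.
  by apply/(measurable_restrictT _ me); exact: measurable_funTS.
by move=> t et; rewrite patchE mem_set.
Qed.

Lemma integral_EFin (f : R -> R) : rho.-integrable e (EFin \o f) ->
  (\int[rho]_(t in e) (f t)%:E)%E = (E f)%:E.
Proof. by move=> fi; rewrite /Rintegral fineK//; exact: integrable_fin_num. Qed.

Let intB (f g : R -> R) : rho.-integrable e (EFin \o f) ->
  rho.-integrable e (EFin \o g) ->
  rho.-integrable e (EFin \o (fun t => f t - g t)).
Proof. by move=> fi gi; exact: (integrableB me fi gi). Qed.

Let intD (f g : R -> R) : rho.-integrable e (EFin \o f) ->
  rho.-integrable e (EFin \o g) ->
  rho.-integrable e (EFin \o (fun t => f t + g t)).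
Proof. by move=> fi gi; exact: (integrableD me fi gi). Qed.

Let intZ (k : R) (f : R -> R) : rho.-integrable e (EFin \o f) ->
  rho.-integrable e (EFin \o (fun t => k * f t)).
Proof. by move=> fi; exact: (integrableZl me k fi). Qed.

Section GapPoint.
Context (w : R) (aw : a < w) (wb : w < b).

Let d0 := Num.min (w - a) (b - w).

Lemma gap_dist_gt0 : 0 < d0.
Proof. by rewrite lt_min !subr_gt0 aw. Qed.

Lemma gap_dist_le t : e t -> d0 <= `|w - t|.
Proof.
move=> /gap[ta|bt].
  rewrite ge_min; apply/orP; left.
  by rewrite ger0_norm ?lerD2l ?lerN2// subr_ge0 (le_trans ta)// ltW.
rewrite ge_min; apply/orP; right.
by rewrite ler0_norm ?opprB ?lerD2r// subr_le0 (le_trans _ bt)// ltW.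
Qed.

Lemma gap_point_neq t : e t -> w - t != 0.
Proof. by move=> /gap_dist_le h; rewrite -normr_gt0 (lt_le_trans gap_dist_gt0). Qed.

Let wC t : e t -> `|w - t| <= C.
Proof. by apply: eC; rewrite !ltW. Qed.

Let C0 : 0 < C. Proof. exact: lt_le_trans ltr01 C1. Qed.

Lemma integrable_ln_dist : rho.-integrable e (EFin \o (fun t => ln `|w - t|)).
Proof.
apply: (@bounded_integrable_on _ (Num.max `|ln d0| `|ln C|)).
  apply: measurable_funTS; apply: (measurableT_comp (@measurable_ln R)).
  apply: (measurableT_comp (@normr_measurable R setT)).
  exact: measurable_funB.
move=> t et; have dw := gap_dist_le et; have d00 := gap_dist_gt0.
have w0 : 0 < `|w - t| by exact: lt_le_trans dw.
have h1 : ln d0 <= ln `|w - t| by rewrite ler_ln.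
have h2 : ln `|w - t| <= ln C by rewrite ler_ln// wC.
rewrite ler_norml; apply/andP; split.
  apply: le_trans h1; rewrite lerNl le_max; apply/orP; left.
  by rewrite -normrN ler_norm.
by apply: le_trans h2 _; rewrite le_max; apply/orP; right; rewrite ler_norm.
Qed.

(* Measurability: 1 / u = u exp (- 2 ln |u|) for u != 0. *)
Lemma integrable_inv_dist : rho.-integrable e (EFin \o (fun t => (w - t)^-1)).
Proof.
apply: (@bounded_integrable_on _ d0^-1).
  apply: (@eq_measurable_fun _ _ (measurableTypeR R) R _
    (fun t => (w - t) * expR (ln `|w - t| * - 2))).
    move=> t /set_mem et; have w0 := gap_point_neq et.
    rewrite mulrN mulr_natr expRN -lnXn ?normr_gt0// lnK ?posrE ?exprn_gt0 ?normr_gt0//.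
    by rewrite real_normK ?num_real//; field.
  apply: measurable_funTS; apply: measurable_funM; first exact: measurable_funB.
  apply: (measurableT_comp (@measurable_expR R)); apply: measurable_funM => //.
  apply: (measurableT_comp (@measurable_ln R)).
  apply: (measurableT_comp (@normr_measurable R setT)).
  exact: measurable_funB.
move=> t et; rewrite normfV lef_pV2 ?posrE ?normr_gt0 ?gap_point_neq//.
  exact: gap_dist_le.
exact: gap_dist_gt0.
Qed.

Definition gap_value := ln C - E (fun t => ln `|w - t|).
(** Minus the derivative of [gap_value] at w, that is, the derivative of the Green's function along
    the line. *)
Definition gap_slope := E (fun t => (w - t)^-1).

Lemma integrable_cst_on (k : R) : rho.-integrable e (EFin \o (fun=> k)).
Proof. by apply: (@bounded_integrable_on _ `|k|). Qed.

Lemma Rintegral_cst_on (k : R) : E (fun=> k) = k.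
Proof.
rewrite Rintegral_cst//.
have -> : fine (rho e) = 1 by rewrite supported_probability.
by rewrite mulr1.
Qed.

Lemma logpot_gap : logpot C rho w = gap_value%:E.
Proof.
have il := integrable_ln_dist; have ic := integrable_cst_on (ln C).
rewrite /logpot supported_integral; last exact: measurable_kapB.
transitivity (\int[rho]_(t in e) (ln C - ln `|w - t|)%:E)%E.
  apply: eq_integral => t /set_mem et.
  by rewrite kapE ?gap_point_neq// wC.
rewrite integral_EFin; last exact: intB.
by rewrite RintegralB// Rintegral_cst_on.
Qed.

(** For t in [e], x and w lie on the same side of t, so (x - t) / (w - t) = 1 + u with u > -1, and
    [ln1D_le_quadratic] applies to log |x - t|. The bound includes the endpoints a and b. *)
Lemma logpot_gap_lower : exists2 c, 0 < c &
  forall x, a <= x <= b ->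
    ((gap_value - gap_slope * (x - w) + c * (x - w) ^+ 2)%:E <= logpot C rho x)%E.
Proof.
have d00 := gap_dist_gt0.
(* With u = (x - w) / (w - t), the quadratic term u^2 / (4 + 2u) is (x - w)^2 / (|w - t|^2 (2 + 2(1
   + u))), where |w - t| <= C and 1 + u <= C / d0. *)
pose c := (C ^+ 2 * (2 + 2 * (C / d0)))^-1.
have Cd : 0 < C / d0 by rewrite divr_gt0.
have c0 : 0 < c by rewrite invr_gt0 mulr_gt0 ?exprn_gt0//; lra.
exists c => // x xab.
have il := integrable_ln_dist; have ii := integrable_inv_dist.
pose phi t := ln C - ln `|w - t| - (x - w) * (w - t)^-1 + c * (x - w) ^+ 2.
have i1 : rho.-integrable e (EFin \o (fun t => ln C - ln `|w - t|)).
  by apply: intB => //; exact: integrable_cst_on.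
have i2 : rho.-integrable e (EFin \o (fun t => (x - w) * (w - t)^-1)).
  exact: intZ.
have i3 : rho.-integrable e
    (EFin \o (fun t => ln C - ln `|w - t| - (x - w) * (w - t)^-1)).
  exact: intB.
have iphi : rho.-integrable e (EFin \o phi).
  by apply: intD => //; exact: integrable_cst_on.
have -> : gap_value - gap_slope * (x - w) + c * (x - w) ^+ 2 = E phi.
  rewrite RintegralD//; last exact: integrable_cst_on.
  rewrite RintegralB// RintegralB//; last exact: integrable_cst_on.
  rewrite RintegralZl// !Rintegral_cst_on /gap_value /gap_slope; ring.
rewrite -integral_EFin// /logpot supported_integral; last exact: measurable_kapB.
have mk : measurable_fun (e : set (measurableTypeR R)) (fun t => kap C (x - t)).
  by apply: measurable_funTS; exact: measurable_kapB.
suff le_phi t : e t -> ((phi t)%:E <= kap C (x - t))%E.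
  (* [phi] may be negative; [kap] is nonnegative, so it dominates the positive part of [phi] as
     well. *)
  apply: (@le_trans _ _ (\int[rho]_(t in e) (EFin \o phi)^\+%E t)%E).
    rewrite integralE -[leRHS]adde0 leeD2l// leeNl oppe0.
    by apply: integral_ge0.
  apply: ge0_le_integral => //.
    by apply: measurable_funepos; case/integrableP: iphi.
  move=> t et; rewrite funeposE /= ge_max kap_ge0 andbT.
  exact: le_phi.
move=> et; have [xt0|xt0] := eqVneq (x - t) 0; first by rewrite /kap xt0 eqxx leey.
have xC : `|x - t| <= C by exact: eC.
have wt0 := gap_point_neq et; have dw := gap_dist_le et.
rewrite kapE// lee_fin /phi.
pose u := (x - w) / (w - t).
have uE : 1 + u = (x - t) / (w - t) by rewrite /u; field.
have u1 : 0 < 1 + u.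
  rewrite uE; have /andP[ax xb] := xab; case: (gap et) => [ta|bt].
    have xt : 0 < x - t by rewrite lt_neqAle eq_sym xt0 subr_ge0 (le_trans ta).
    by rewrite divr_gt0// subr_gt0 (le_lt_trans ta).
  have xt : 0 < t - x
    by rewrite lt_neqAle eq_sym subr_eq0 eq_sym -subr_eq0 xt0 subr_ge0 (le_trans xb).
  by rewrite -mulrNN -invrN !opprB divr_gt0// subr_gt0 (lt_le_trans wb).
have wt00 : 0 < `|w - t| by rewrite normr_gt0.
have -> : ln `|x - t| = ln `|w - t| + ln (1 + u).
  rewrite -lnM ?posrE//; congr ln.
  by rewrite -(gtr0_norm u1) uE normrM normfV mulrC divfK// gt_eqF.
have := @ln1D_le_quadratic _ u; rewrite -subr_gt0 opprK addrC u1 => /(_ isT).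
have -> : (x - w) * (w - t)^-1 = u by [].
suff : c * (x - w) ^+ 2 <= u ^+ 2 / (4 + 2 * u) by lra.
have uC : 1 + u <= C / d0.
  rewrite -(gtr0_norm u1) uE normrM normfV ler_pM// ?invr_ge0//.
  by rewrite lef_pV2.
have -> : u ^+ 2 / (4 + 2 * u) = (x - w) ^+ 2 * (`|w - t| ^+ 2 * (2 + 2 * (1 + u)))^-1.
  rewrite real_normK ?num_real// /u; field.
  have -> : 2 * (w - t) + 2 * (w - t + (x - w)) = (w - t) * (2 + 2 * (1 + u)).
    by rewrite uE; field.
  by rewrite wt0 mulf_neq0// gt_eqF//; lra.
rewrite mulrC ler_wpM2l ?sqr_ge0// lef_pV2 ?posrE ?mulr_gt0 ?exprn_gt0//; try lra.
apply: ler_pM; rewrite ?sqr_ge0//; try lra.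
by rewrite lerXn2r ?nnegrE ?wC// ltW.
Qed.

End GapPoint.
End GapPotential.

Section ZeroDifferential.
Context {R : realType} {V W : normedModType R}.

Lemma zero_differential (f : V -> W) (x : V) (K d : R) : 0 < d -> 0 < K ->
  (forall h, `|h| <= d -> `|f (h + x) - f x| <= K * `|h| ^+ 2) ->
  differentiable f x /\ forall v, 'd f x v = 0.
Proof.
move=> d0 K0 fK.
have fo : f \o shift x = cst (f x) + (\0 : V -> W) +o_ 0 id.
  apply/eqaddoP => eps eps0.
  have e0 : 0 < Num.min d (eps / K) by rewrite lt_min d0 divr_gt0.
  have : \forall h \near (0 : V), `|h| < Num.min d (eps / K).
    by apply/nbhs_ballP; exists (Num.min d (eps / K)) => //= h;
      rewrite -ball_normE /= sub0r normrN.
  apply: filterS => h; rewrite lt_min => /andP[hd hK].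
  rewrite [X in `|X|](_ : _ = f (h + x) - f x); last first.
    by rewrite /= !fctE /= addr0.
  apply: le_trans (fK _ (ltW hd)) _.
  rewrite expr2 mulrA ler_wpM2r// -ler_pdivlMl// mulrC.
  exact: ltW.
have c0 : continuous (\0 : V -> W) by move=> y; exact: cvg_cst.
have dE := diff_unique c0 fo.
split; last by move=> v; rewrite dE.
by apply/diff_locallyP; rewrite dE; split.
Qed.

End ZeroDifferential.

Section GapCriticalPoint.
Context {R : realType} (e : set R) (rho : probability (measurableTypeR R) R).
Context (C a b : R) (me : measurable (e : set (measurableTypeR R)))
  (rhoe : supported_on e rho) (C1 : 1 <= C)
  (eC : forall x t, a <= x <= b -> e t -> `|x - t| <= C)
  (gap : forall t, e t -> t <= a \/ b <= t).

Local Notation E f := (\int[rho]_(t in e) f t)%R.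
Local Notation gv := (gap_value e rho C).
Local Notation gs := (gap_slope e rho).

Lemma log_kernel_cplx (x y t : R) : log_kernel (x +i* y) t%:C =
  if (x - t) ^+ 2 + y ^+ 2 == 0 then +oo%E
  else (- (2^-1 * ln ((x - t) ^+ 2 + y ^+ 2)))%:E.
Proof.
have -> : log_kernel (x +i* y) t%:C =
    (- lne (Num.sqrt ((x - t) ^+ 2 + y ^+ 2))%:E)%E.
  by rewrite /log_kernel /Normc.normc /= oppr0 addr0.
have q0 : 0 <= (x - t) ^+ 2 + y ^+ 2 by rewrite addr_ge0 ?sqr_ge0.
have [->|qn0] := eqVneq; first by rewrite sqrtr0 /= lexx.
have qp : 0 < (x - t) ^+ 2 + y ^+ 2 by rewrite lt_neqAle eq_sym qn0.
rewrite lne_EFin ?sqrtr_gt0// -EFinN; congr _%:E.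
have -> : ln ((x - t) ^+ 2 + y ^+ 2) = ln (Num.sqrt ((x - t) ^+ 2 + y ^+ 2)) *+ 2.
  by rewrite -lnXn ?sqrtr_gt0// sqr_sqrtr.
by congr (- _); field.
Qed.

Lemma measurable_log_kernel_cplx (x y : R) :
  measurable_fun [set: measurableTypeR R] (fun t : R => log_kernel (x +i* y) t%:C).
Proof.
have mq : measurable_fun [set: measurableTypeR R]
    (fun t : R => (x - t) ^+ 2 + y ^+ 2).
  apply: measurable_funD => //; apply: measurable_funX.
  exact: measurable_funB.
under eq_fun do rewrite log_kernel_cplx.
apply: measurable_fun_ifT => //=; first exact: measurable_fun_eqr.
apply/measurable_EFinP; apply: measurable_funN; apply: measurable_funM => //.
exact: (measurableT_comp (@measurable_ln R)).
Qed.

(** [ln_norm_expansion] integrated over t. The imaginary displacement h2 has no linear term, so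
    criticality in the plane reduces to a vanishing slope along the line. *)
Lemma potential_expansion w : a < w -> w < b ->
  exists d K, [/\ 0 < d, 0 < K & forall h1 h2, `|h1| <= d -> `|h2| <= d ->
   exists2 p, potential rho ((w + h1) +i* h2) = p%:E &
     `|p - (gv w - ln C) + gs w * h1| <= K * (h1 ^+ 2 + h2 ^+ 2)].
Proof.
move=> aw wb; pose d0 := Num.min (w - a) (b - w).
have d00 : 0 < d0 by exact: gap_dist_gt0.
have dd0 t : e t -> d0 <= `|w - t| by exact: gap_dist_le.
exists (d0 / 8), (20 / d0 ^+ 2); split; [by rewrite divr_gt0|by rewrite divr_gt0 ?exprn_gt0|].
move=> h1 h2 h1d h2d.
pose q t := 2^-1 * ln ((w + h1 - t) ^+ 2 + h2 ^+ 2).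
have expn t : e t -> 0 < (w + h1 - t) ^+ 2 + h2 ^+ 2 /\
    `|q t - ln `|w - t| - h1 * (w - t)^-1| <= 20 / d0 ^+ 2 * (h1 ^+ 2 + h2 ^+ 2).
  move=> et; have [] := ln_norm_expansion d00 (dd0 _ et) h1d h2d.
  by rewrite /q addrAC.
set K := 20 / d0 ^+ 2 * _ in expn *.
have il := integrable_ln_dist rho me C1 eC gap aw wb.
have ii : rho.-integrable e (EFin \o (fun t => h1 * (w - t)^-1)).
  exact: (integrableZl me _ (integrable_inv_dist rho me gap aw wb)).
have mq : measurable_fun (e : set (measurableTypeR R)) q.
  apply: measurable_funTS; apply: measurable_funM => //.
  apply: (measurableT_comp (@measurable_ln R)).
  apply: measurable_funD => //; apply: measurable_funX.
  exact: measurable_funB.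
pose D t := q t - ln `|w - t| - h1 * (w - t)^-1.
have iD : rho.-integrable e (EFin \o D).
  apply: (@bounded_integrable_on _ _ rho me _ K).
    apply: measurable_funB; last by case/integrableP: ii => /measurable_EFinP.
    by apply: measurable_funB => //; case/integrableP: il => /measurable_EFinP.
  by move=> t /expn[].
have qE : q = fun t => D t + ln `|w - t| + h1 * (w - t)^-1.
  by apply/funext => t; rewrite /D; ring.
have iDl : rho.-integrable e (EFin \o (fun t => D t + ln `|w - t|)).
  exact: (integrableD me iD il).
have iq : rho.-integrable e (EFin \o q).
  by rewrite qE; exact: (integrableD me iDl ii).
exists (- E q).
  rewrite /potential (supported_integral me rhoe (measurable_log_kernel_cplx _ _)).
  transitivity (\int[rho]_(t in e) (- q t)%:E)%E.
    apply: eq_integral => t /set_mem /expn[q0 _].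
    by rewrite log_kernel_cplx gt_eqF.
  rewrite (integral_EFin me); last by exact: (integrableN iq).
  congr EFin; rewrite -[RHS]mulN1r -RintegralZl//.
  by apply: eq_Rintegral => t _; rewrite mulN1r.
have -> : E q = E D + E (fun t => ln `|w - t|) + h1 * gs w.
  rewrite qE RintegralD// RintegralD// RintegralZl//.
  exact: (integrable_inv_dist rho me gap aw wb).
rewrite /gap_value.
set l := E (fun t => ln _).
have -> : - (E D + l + h1 * gs w) - (ln C - l - ln C) + gs w * h1 = - E D by ring.
rewrite normrN; apply: le_trans (le_normr_Rintegral me iD) _.
rewrite -[leRHS](Rintegral_cst_on me rhoe); apply: le_Rintegral => //.
- by have := integrable_abse iD.
- exact: integrable_cst_on.
- by move=> t /expn[].
Qed.

Lemma gap_value_expansion w : a < w -> w < b ->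
  exists d K, [/\ 0 < d, 0 < K & forall h, `|h| <= d -> a < w + h -> w + h < b ->
     `|gv (w + h) - gv w + gs w * h| <= K * h ^+ 2].
Proof.
move=> aw wb; have [d [K [d0 K0 dK]]] := potential_expansion aw wb.
exists d, K; split => // h hd awh whb.
have [|p pE] := dK h 0 hd; first by rewrite normr0 ltW.
have awh' : a <= w + h <= b by rewrite !ltW.
have := pE; rewrite (_ : (w + h) +i* 0 = (w + h)%:C)//.
rewrite (potentialE me rhoe C1); last by move=> t; exact: eC.
rewrite (logpot_gap me rhoe C1 eC gap awh whb) -EFinB => -[<-].
by rewrite expr0n addr0; congr (`| _ | <= _); ring.
Qed.

Lemma gap_value_continuous w : a < w -> w < b -> {for w, continuous gv}.
Proof.
move=> aw wb; have [d [K [d0 K0 dK]]] := gap_value_expansion aw wb.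
apply/cvgrPdist_le => eps eps0.
pose L := `|gs w| + K * d.
have L0 : 0 < L by rewrite ltr_wpDl// mulr_gt0.
pose r := Num.min (Num.min d (eps / L)) (Num.min (w - a) (b - w)).
have r0 : 0 < r by rewrite !lt_min d0 divr_gt0//= !subr_gt0 aw wb.
apply/nbhs_ballP; exists r => //= x xr; have : `|w - x| < r by exact: xr.
rewrite !lt_min => /andP[/andP[xd xe] /andP[xa xb]].
have {}xa : a < x by move: xa; rewrite ltr_norml => /andP[]; lra.
have {}xb : x < b by move: xb; rewrite ltr_norml => /andP[]; lra.
have xE : w + (x - w) = x by ring.
have := dK (x - w); rewrite xE distrC => /(_ (ltW xd) xa xb) h.
rewrite distrC; have -> : gv x - gv w = (gv x - gv w + gs w * (x - w)) - gs w * (x - w) by ring.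
apply: (le_trans (ler_normB _ _)).
apply: (@le_trans _ _ (K * (x - w) ^+ 2 + `|gs w| * `|w - x|)).
  by rewrite lerD// normrM (distrC x).
have -> : (x - w) ^+ 2 = `|w - x| * `|w - x|.
  by rewrite -expr2 real_normK ?num_real//; ring.
apply: (@le_trans _ _ (L * `|w - x|)).
  rewrite /L mulrDl addrC lerD2l mulrA ler_wpM2r// ler_wpM2l ?(ltW K0)//.
  exact: ltW.
by rewrite -ler_pdivlMl// mulrC ltW.
Qed.

End GapCriticalPoint.

(** * The maximum of the Green's function over a gap *)

Section GapMaximum.
Context {R : realType} (e : set R) (rho : probability (measurableTypeR R) R).
Context (C a b rr : R) (me : measurable (e : set (measurableTypeR R)))
  (rhoe : supported_on e rho) (C1 : 1 <= C)
  (eC : forall x t, a <= x <= b -> e t -> `|x - t| <= C)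
  (gap : forall t, e t -> t <= a \/ b <= t)
  (ab : a < b) (rrE : robin e = rr%:E)
  (Va : logpot C rho a = (rr + ln C)%:E) (Vb : logpot C rho b = (rr + ln C)%:E).

Local Notation gv := (gap_value e rho C).
Local Notation gs := (gap_slope e rho).

Let m := (a + b) / 2.
Let am : a < m. Proof. exact: (midf_lt ab).1. Qed.
Let mb : m < b. Proof. exact: (midf_lt ab).2. Qed.

(* The two tangent estimates at the midpoint, evaluated at a and at b, have
   opposite linear terms. *)
Lemma gap_value_midpoint : gv m < rr + ln C.
Proof.
have [c c0 cP] := logpot_gap_lower me rhoe C1 eC gap am mb.
have := cP a; rewrite lexx ltW// Va lee_fin => /(_ isT) ha.
have := cP b; rewrite lexx ltW// Vb lee_fin => /(_ isT) hb.
have E1 : a - m = - (b - m) by rewrite /m; lra.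
have c1 : 0 < c * (b - m) ^+ 2 by rewrite mulr_gt0// exprn_gt0// subr_gt0.
move: ha; rewrite E1 sqrrN mulrN opprK.
move: c1 hb; set p := c * _; set q := gs m * _. lra.
Qed.

(** Otherwise semicontinuity would carry the bound gv m to b, against [gap_value_midpoint]. With its
    mirror image at a, this forces the minimum of gv into the interior. *)
Lemma gap_value_near_right : exists2 b', m < b' < b & gv m < gv b'.
Proof.
apply/not_exists2P => H.
(* The divisor starts at 2, so that already the first term is strictly to the right of m. *)
pose x_ (n : nat) := b - (b - m) / n.+2%:R.
have x_in n : m < x_ n < b.
  have n0 : (0 : R) < n.+2%:R by rewrite ltr0n.
  rewrite /x_ ltrBlDr ltrDl divr_gt0 ?subr_gt0// andbT.
  rewrite ltrBrDl -ltrBrDr ltr_pdivrMr// ltr_pMr ?subr_gt0//.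
  by rewrite ltr1n.
have x_cvg : x_ @ \oo --> b.
  rewrite -[X in _ --> X]subr0 -(mulr0 (b - m)).
  apply: cvgB; first exact: cvg_cst.
  apply: cvgM; first exact: cvg_cst.
  have := @cvg_harmonic R; rewrite -(cvg_shiftS _) => h.
  by rewrite [X in X @ _](_ : _ = (fun n => harmonic n.+1)).
have : (logpot C rho b <= (gv m)%:E)%E.
  apply: (logpot_le_lim x_cvg) => n.
  have /andP[mx xb] := x_in n.
  rewrite (logpot_gap me rhoe C1 eC gap (lt_trans am mx) xb) lee_fin leNgt.
  by apply/negP => h; case: (H (x_ n)); [rewrite x_in|rewrite h].
by rewrite Vb lee_fin leNgt gap_value_midpoint.
Qed.

Lemma gap_value_near_left : exists2 a', a < a' < m & gv m < gv a'.
Proof.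
apply/not_exists2P => H.
pose x_ (n : nat) := a + (m - a) / n.+2%:R.
have x_in n : a < x_ n < m.
  have n0 : (0 : R) < n.+2%:R by rewrite ltr0n.
  rewrite /x_ ltrDl divr_gt0 ?subr_gt0//=.
  by rewrite -ltrBrDl ltr_pdivrMr// ltr_pMr ?subr_gt0// ltr1n.
have x_cvg : x_ @ \oo --> a.
  rewrite -[X in _ --> X]addr0 -(mulr0 (m - a)).
  apply: cvgD; first exact: cvg_cst.
  apply: cvgM; first exact: cvg_cst.
  have := @cvg_harmonic R; rewrite -(cvg_shiftS _) => h.
  by rewrite [X in X @ _](_ : _ = (fun n => harmonic n.+1)).
have : (logpot C rho a <= (gv m)%:E)%E.
  apply: (logpot_le_lim x_cvg) => n.
  have /andP[ax xm] := x_in n.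
  rewrite (logpot_gap me rhoe C1 eC gap ax (lt_trans xm mb)) lee_fin leNgt.
  by apply/negP => h; case: (H (x_ n)); [rewrite x_in|rewrite h].
by rewrite Va lee_fin leNgt gap_value_midpoint.
Qed.

Lemma gap_slope_zero : exists w, [/\ a < w, w < b & gs w = 0].
Proof.
have [b' /andP[mb' b'b] gb] := gap_value_near_right.
have [a' /andP[aa' a'm] ga] := gap_value_near_left.
have ab' : a' <= b' by rewrite ltW// (lt_trans a'm).
have cgv : {within `[a', b'], continuous gv}.
  apply: continuous_in_subspaceT => x /set_mem /=; rewrite in_itv /= => /andP[ax xb].
  apply: (gap_value_continuous me rhoe C1 eC gap).
    exact: lt_le_trans ax.
  exact: le_lt_trans b'b.
have [w] := EVT_min ab' cgv; rewrite in_itv /= => /andP[a'w wb'] wmin.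
have wm : gv w <= gv m by apply: wmin; rewrite in_itv /= !ltW.
have a'w1 : a' < w.
  by rewrite lt_neqAle a'w andbT; apply: contraTN isT => /eqP E; move: ga; rewrite E ltNge wm.
have wb'1 : w < b'.
  by rewrite lt_neqAle wb' andbT; apply: contraTN isT => /eqP E; move: gb; rewrite -E ltNge wm.
have aw : a < w by exact: lt_trans a'w1.
have wb : w < b by exact: lt_trans wb'1 _.
exists w; split => //; apply/eqP; apply/negPn/negP => g0.
have [d [K [d0 K0 dK]]] := gap_value_expansion me rhoe C1 eC gap aw wb.
have gn0 : 0 < `|gs w| by rewrite normr_gt0.
pose r := Num.min (Num.min d (`|gs w| / (2 * K))) (Num.min (w - a') (b' - w)).
have r0 : 0 < r by rewrite !lt_min d0 !subr_gt0 a'w1 wb'1 divr_gt0// mulr_gt0.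
have rd : r <= d by rewrite /r !ge_min lexx.
have rK : r <= `|gs w| / (2 * K) by rewrite /r !ge_min lexx orbT.
have ra : r <= w - a' by rewrite /r !ge_min lexx !orbT.
have rb : r <= b' - w by rewrite /r !ge_min lexx !orbT.
(* The derivative of gv is - gs, so this step decreases gv to first order; r <= |gs w| / (2K) keeps
   the quadratic error smaller. *)
pose h := Num.sg (gs w) * r.
have hr : `|h| = r by rewrite normrM normr_sg g0 mul1r gtr0_norm.
have /andP[h1 h2] : - r <= h <= r by rewrite -ler_norml hr.
have := dK h; rewrite hr => /(_ rd).
have -> : a < w + h by lra.
have -> : w + h < b by lra.
move=> /(_ isT isT); rewrite ler_norml => /andP[_].
have -> : gs w * h = `|gs w| * r.
  by rewrite /h mulrCA mulrA -normrEsg.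
have -> : h ^+ 2 = r ^+ 2 by rewrite -hr real_normK ?num_real.
have : gv w <= gv (w + h) by apply: wmin; rewrite in_itv /=; apply/andP; split; lra.
have : K * r ^+ 2 < `|gs w| * r.
  rewrite expr2 mulrA ltr_pM2r//.
  by move: rK; rewrite ler_pdivlMr ?mulr_gt0//; nra.
lra.
Qed.

(** In terms of G the last clause is G(x) <= gam - c (x - w)^2: the maximum over the gap is a
    critical value, with a quantitative loss away from w that serves the equality case. *)
Lemma gap_critical_point : exists w c gam,
  [/\ a < w < b, 0 < c, green_critical e rho w%:C,
      green e rho w%:C = gam%:E &
      forall x, a <= x <= b ->
        ((rr + ln C - gam + c * (x - w) ^+ 2)%:E <= logpot C rho x)%E].
Proof.
have [w [aw wb gs0]] := gap_slope_zero.
have [c c0 cP] := logpot_gap_lower me rhoe C1 eC gap aw wb.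
exists w, c, (rr + ln C - gv w); split => //; first by rewrite aw.
- have [d [K [d0 K0 dK]]] := potential_expansion me rhoe C1 eC gap aw wb.
  have fE h1 h2 : `|h1| <= d -> `|h2| <= d ->
      `|green2 e rho (w + h1, h2) - (rr - (gv w - ln C))| <= K * (h1 ^+ 2 + h2 ^+ 2).
    move=> h1d h2d; have [p pE] := dK _ _ h1d h2d; rewrite gs0 mul0r addr0.
    rewrite /green2 /green rrE pE -EFinB /= -normrN.
    by congr (`| _ | <= _); ring.
  have f0 : green2 e rho (w, 0) = rr - (gv w - ln C).
    have := fE 0 0; rewrite normr0 addr0 => /(_ (ltW d0) (ltW d0)).
    by rewrite expr0n addr0 mulr0 normr_le0 subr_eq0 => /eqP.
  (* Pairs carry the maximum norm, so h1^2 + h2^2 is at most twice the squared norm. *)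
  apply: (@zero_differential R _ _ (green2 e rho) (w, 0) (2 * K) d) => //.
    by rewrite mulr_gt0.
  move=> [h1 h2]; rewrite !prod_normE /= ge_max => /andP[h1d h2d].
  rewrite f0 [X in green2 e rho X](_ : _ = (w + h1, h2)); last first.
    by congr (_, _); rewrite /= ?addr0// addrC.
  apply: le_trans (fE _ _ h1d h2d) _.
  rewrite -mulrA mulrCA ler_pM2l//.
  set M := Num.max _ _.
  have l1 : h1 ^+ 2 <= M ^+ 2.
    by rewrite -real_normK ?num_real// lerXn2r ?nnegrE ?le_max ?normr_ge0 ?lexx.
  have l2 : h2 ^+ 2 <= M ^+ 2.
    by rewrite -[leLHS]real_normK ?num_real// lerXn2r ?nnegrE ?le_max ?normr_ge0 ?lexx ?orbT.
  lra.
- rewrite /green rrE (potentialE me rhoe C1); last by move=> t; apply: eC; rewrite !ltW.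
  rewrite (logpot_gap me rhoe C1 eC gap aw wb) -!EFinB; congr EFin; ring.
- move=> x xab; have := cP x xab; rewrite gs0 mul0r subr0.
  by have -> : rr + ln C - (rr + ln C - gv w) = gv w by ring.
Qed.

End GapMaximum.

(** * Averaging over the values of the polynomial *)

Section Doubling.
Context {R : realType} (e B : set R) (rho : probability (measurableTypeR R) R).
Context (M : R) (me : measurable (e : set (measurableTypeR R)))
  (rhoe : supported_on e rho) (M0 : 0 < M) (Be : B `<=` e)
  (B0 : lebesgue_measure.-negligible B).
Implicit Types (f : R -> R) (a y z : R).

(** A class that contains [P], is stable under composition with q, and whose members map null
    subsets of [e] to null sets. *)
Definition admissible f := [/\ measurable_fun [set: measurableTypeR R] f,
  forall t, e t -> `|f t| <= M &
  exists2 L, 0 < L & forall s t, e s -> e t -> `|f s - f t| <= L * `|s - t|].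

(** For |f| <= M on [e] and |y| < M this is log (2M) minus the mean of log |f - y|. The threshold
    log (M / 2) thus becomes log 4, with inequalities reversed. *)
Definition log_average f y : \bar R := (\int[rho]_t kap (2 * M) (f t - y))%E.

(* q (M cos t) = M cos (2 t); its inverse branches are h and - h. *)
Let q s := 2 / M * s ^+ 2 - M.

Let h z := Num.sqrt (M * (M + z) / 2).

Let M2 : 0 < 2 * M. Proof. by rewrite mulr_gt0. Qed.

Let measurable_kapf f y : measurable_fun [set: measurableTypeR R] f ->
  measurable_fun [set: measurableTypeR R] (fun t => kap (2 * M) (f t - y)).
Proof.
by move=> mf; apply: (measurableT_comp (measurable_kap _)); exact: measurable_funB.
Qed.

Lemma admissible_double f : admissible f -> admissible (q \o f).
Proof.
move=> [mf fM [L L0 fL]]; split.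
- apply: measurable_funB => //; apply: measurable_funM => //.
  exact: measurable_funX.
- move=> t /fM ft /=; have : `|f t| ^+ 2 <= M ^+ 2 by rewrite lerXn2r ?nnegrE// ltW.
  rewrite real_normK ?num_real// => ft2.
  have : 2 / M * f t ^+ 2 <= 2 / M * M ^+ 2 by rewrite ler_pM2l// divr_gt0.
  have -> : 2 / M * M ^+ 2 = 2 * M by field; rewrite gt_eqF.
  have : 0 <= 2 / M * f t ^+ 2 by rewrite mulr_ge0 ?sqr_ge0// divr_ge0// ltW.
  by rewrite /q ler_norml => ? ?; apply/andP; split; lra.
- exists (4 * L); first by rewrite mulr_gt0.
  move=> s t es et /=.
  have -> : q (f s) - q (f t) = 2 / M * ((f s - f t) * (f s + f t)).
    by rewrite /q; ring.
  have M20 : 0 < 2 / M by rewrite divr_gt0.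
  rewrite normrM (gtr0_norm M20) normrM.
  apply: (@le_trans _ _ (2 / M * (L * `|s - t| * (M + M)))).
    rewrite ler_pM2l ?divr_gt0//; apply: ler_pM => //; first exact: fL.
    by apply: le_trans (ler_normD _ _) _; rewrite lerD ?fM.
  by rewrite le_eqVlt; apply/orP; left; apply/eqP; field; rewrite gt_eqF.
Qed.

Lemma half_angle z : `|z| < M -> 0 < h z < M /\ q (h z) = z.
Proof.
rewrite ltr_norml => /andP[z1 z2].
have p0 : 0 < M * (M + z) / 2 by rewrite divr_gt0// mulr_gt0//; lra.
have hE : h z ^+ 2 = M * (M + z) / 2 by rewrite sqr_sqrtr// ltW.
split; last by rewrite /q hE; field; rewrite gt_eqF.
rewrite sqrtr_gt0 p0 /= -(@ltr_pXn2r _ 2) ?nnegrE ?sqrtr_ge0 ?(ltW M0)//.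
by rewrite hE expr2 ltr_pdivrMr// -mulrA ltr_pM2l//; lra.
Qed.

(* q f - z = (2 / M) (f - h z) (f + h z) *)
Lemma log_average_double f z : admissible f -> `|z| < M ->
  (log_average (q \o f) z + (ln 4)%:E =
   log_average f (h z) + log_average f (- h z))%E.
Proof.
move=> af zM; have [mqf qfM _] := admissible_double af.
have [mf fM _] := af; have [/andP[h0 hM] qh] := half_angle zM.
have ln40 : 0 <= ln 4 :> R by rewrite ln_ge0// ler1n.
rewrite /log_average -[X in (_ + X)%E](integral_prob_cst rho).
rewrite -!ge0_integralD//; try by move=> t _; exact: kap_ge0.
- apply: (supported_ae_eq_integral me rhoe).
  + by apply: emeasurable_funD => //; exact: measurable_kapf.
  + by apply: emeasurable_funD; exact: measurable_kapf.
  move=> t et; have ft := fM _ et; have qft := qfM _ et.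
  have b1 : `|f t - h z| <= 2 * M.
    by move: ft; rewrite !ler_norml => /andP[? ?]; apply/andP; split; lra.
  have b2 : `|f t - - h z| <= 2 * M.
    by move: ft; rewrite !ler_norml => /andP[? ?]; apply/andP; split; lra.
  have b3 : `|(q \o f) t - z| <= 2 * M.
    move: qft zM; rewrite ler_norml ltr_norml => /andP[? ?] /andP[? ?].
    by rewrite ler_norml; apply/andP; split; lra.
  rewrite -kapM//.
  have M20 : 0 < 2 / M by rewrite divr_gt0.
  have qE : (q \o f) t - z = 2 / M * ((f t - h z) * (f t - - h z)).
    by rewrite -[in LHS]qh /q /=; ring.
  have b4 : `|(f t - h z) * (f t - - h z)| <= 2 * M * (2 * M).
    by rewrite normrM ler_pM.
  (* The factors 2 / M, f - h z and f + h z are bounded by 2 / M, 2M and 2M. The product 8M of these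
     bounds is 4 times 2M, whence the term log 4. *)
  have kE : kap (2 / M * (2 * M * (2 * M))) ((q \o f) t - z) =
      kap (2 * M * (2 * M)) ((f t - h z) * (f t - - h z)).
    have k1 : kap (2 / M) (2 / M) = 0%E.
      have n2 : `|2 / M| = 2 / M by exact: gtr0_norm.
      by rewrite kapE ?n2 ?subrr// gt_eqF.
    by rewrite qE (@kapM _ (2 / M)) ?k1 ?add0e// gtr0_norm.
  rewrite -kE.
  have E8 : 2 / M * (2 * M * (2 * M)) = 8 * M by field; rewrite gt_eqF.
  have b5 : `|(q \o f) t - z| <= 8 * M by apply: le_trans b3 _; lra.
  rewrite E8; have [E|n0] := eqVneq ((q \o f) t - z) 0.
    by rewrite E /kap eqxx.
  rewrite !kapE// -EFinD; congr EFin.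
  have -> : 8 * M = 4 * (2 * M) by ring.
  by rewrite [in RHS]lnM ?posrE//; ring.
- exact: measurable_kapf.
- exact: measurable_kapf.
- exact: measurable_kapf.
Qed.

(** Tonelli: integrating over y first gives at most 4 (2M) log 2 for every t, and the interval ]-M,
    M[ has length 2M. The bound is the same for all [f], hence for all iterates. *)
Lemma log_average_lower_bound f a : admissible f ->
  (forall y, `|y| < M -> ~ (f @` B) y -> (a%:E <= log_average f y)%E) ->
  a <= 4 * ln 2.
Proof.
move=> [mf fM [L L0 fL]] fa.
have ln20 : 0 < ln 2 :> R by rewrite ln_gt0// ltr1n.
have [a0|a0] := leP a 0.
  by apply: (le_trans a0); rewrite mulr_ge0// ltW.
pose I : set (measurableTypeR R) := `]- M, M[%classic.
have mI : measurable I by exact: measurable_itv.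
have mk2 : measurable_fun [set: measurableTypeR R * measurableTypeR R]
    (fun p => kap (2 * M) (f p.2 - p.1)).
  apply: (measurableT_comp (measurable_kap _)); apply: measurable_funB.
    by apply: (measurableT_comp mf); exact: measurable_snd.
  exact: measurable_fst.
have mla : measurable_fun [set: measurableTypeR R] (log_average f).
  apply: (measurable_fun_fubini_tonelli_F (m2 := rho)
    (fun p : measurableTypeR R * measurableTypeR R => kap (2 * M) (f p.2 - p.1))) => //.
  by move=> p; exact: kap_ge0.
have la0 y : (0 <= log_average f y)%E by apply: integral_ge0 => t _; exact: kap_ge0.
have up : (\int[lebesgue_measure]_z log_average f z <= (ln 2 * (4 * (2 * M)))%:E)%E.
  rewrite /log_average (fubini_tonelli (m2 := rho)
    (fun p : measurableTypeR R * measurableTypeR R => kap (2 * M) (f p.2 - p.1)))//=.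
    rewrite -(integral_prob_cst rho); apply: ge0_le_integral => //.
    - by move=> t _; apply: integral_ge0 => z _; exact: kap_ge0.
    - apply: (measurable_fun_fubini_tonelli_G (m1 := @lebesgue_measure R)
        (fun p : measurableTypeR R * measurableTypeR R => kap (2 * M) (f p.2 - p.1))) => //.
      by move=> p; exact: kap_ge0.
    - by move=> t _; exact: integral_kap.
  by move=> p; exact: kap_ge0.
have low : (\int[lebesgue_measure]_(z in I) a%:E <=
    \int[lebesgue_measure]_(z in I) log_average f z)%E.
  apply: ae_ge0_le_integral => //.
  - by move=> z _; rewrite lee_fin ltW.
  - exact: measurable_funTS.
  apply: negligibleS (lipschitz_image_negligible L0 _ B0); last first.
    by move=> s t /Be es /Be et; exact: fL.
  move=> z /= nz; apply: contrapT => nB; apply: nz => Iz; apply: fa nB.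
  by move: Iz; rewrite /I /= in_itv /= ltr_norml.
have : (a%:E * (2 * M)%:E <= (ln 2 * (4 * (2 * M)))%:E)%E.
  apply: le_trans up.
  apply: le_trans (_ : _ <= \int[lebesgue_measure]_(z in I) log_average f z)%E _.
    apply: le_trans low; rewrite integral_cst//= lebesgue_measure_itv /= lte_fin.
    by rewrite gtrN// -EFinB opprK lee_pmul2l// lee_fin; lra.
  by apply: ge0_subset_integral => //.
rewrite -EFinM lee_fin.
have -> : ln 2 * (4 * (2 * M)) = 4 * ln 2 * (2 * M) by ring.
by rewrite ler_pM2r.
Qed.

Lemma image_double f x : (f @` B) x -> ((q \o f) @` B) (q x).
Proof. by move=> [t Bt <-]; exists t. Qed.

Lemma not_image_double f z : `|z| < M -> ~ ((q \o f) @` B) z ->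
  ~ (f @` B) (h z) /\ ~ (f @` B) (- h z).
Proof.
move=> zM nB; have [_ qh] := half_angle zM.
split=> /image_double; first by rewrite qh.
by rewrite /q sqrrN -/(q (h z)) qh.
Qed.

Lemma norm_half_angle z : `|z| < M -> `|h z| < M /\ `|- h z| < M.
Proof.
by move=> zM; rewrite normrN; have [/andP[h0 hM] _] := half_angle zM; rewrite gtr0_norm.
Qed.

Lemma log_average_double_bound f a a' z : admissible f -> `|z| < M ->
  (a%:E <= log_average f (h z))%E -> (a'%:E <= log_average f (- h z))%E ->
  ((a + a' - ln 4)%:E <= log_average (q \o f) z)%E.
Proof.
move=> af zM h1 h2; have := log_average_double af zM.
rewrite EFinB leeBlDr// EFinD => ->; exact: leeD.
Qed.

Lemma log_average_le_ln4 f a : admissible f ->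
  (forall y, `|y| < M -> ~ (f @` B) y -> (a%:E <= log_average f y)%E) ->
  a <= ln 4.
Proof.
move=> af fa; rewrite leNgt; apply/negP => a4.
have [f_ [f_0 f_S]] : exists f_ : nat -> R -> R,
    f_ 0%N = f /\ forall n, f_ n.+1 = q \o f_ n.
  by exists (fun n => iter n (fun g => q \o g) f).
(* One doubling turns a lower bound a into 2a - log 4, whose fixed point is log 4; the excess a -
   log 4 doubles at each step and finally exceeds 4 log 2. *)
have key n : admissible (f_ n) /\ forall y, `|y| < M -> ~ (f_ n @` B) y ->
    ((2 ^+ n * (a - ln 4) + ln 4)%:E <= log_average (f_ n) y)%E.
  elim: n => [|n [afn IH]].
    by rewrite f_0 expr0 mul1r subrK.
  rewrite f_S; split; first exact: admissible_double.
  move=> z zM nB; have [n1 n2] := not_image_double zM nB.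
  have [z1 z2] := norm_half_angle zM.
  have := log_average_double_bound afn zM (IH _ z1 n1) (IH _ z2 n2).
  by congr (_%:E <= _)%E; rewrite exprS; ring.
have an0 : 0 < a - ln 4 by rewrite subr_gt0.
have ln40 : 0 <= ln 4 :> R by rewrite ln_ge0// ler1n.
have ln20 : 0 <= ln 2 :> R by rewrite ln_ge0// ler1n.
have [n nP] : exists n : nat, 4 * ln 2 / (a - ln 4) < n%:R.
  by eexists; apply: archi_boundP; rewrite divr_ge0 ?mulr_ge0// ltW.
have [afn bn] := key n; have := log_average_lower_bound afn bn.
apply/negP; rewrite -ltNge; apply: (@lt_le_trans _ _ (n%:R * (a - ln 4))).
  by rewrite -ltr_pdivrMr.
apply: (@le_trans _ _ (2 ^+ n * (a - ln 4))); last by rewrite lerDl.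
by rewrite ler_pM2r// -natrX ler_nat ltnW// ltn_expl.
Qed.

(* Among the four preimages of z under q \o q, the pair of larger modulus
   has modulus at least M / sqrt 2, so one of them is far from any given c. *)
Lemma log_average_gain f a c delta : admissible f -> 0 <= delta ->
  (forall y, `|y| < M -> ~ (f @` B) y -> (a%:E <= log_average f y)%E) ->
  (forall y, `|y| < M -> ~ (f @` B) y -> M / 2 <= `|y - c| ->
     ((a + delta)%:E <= log_average f y)%E) ->
  4 * (a - ln 4) + delta <= 0.
Proof.
move=> af d0 fa fd.
have a1 := admissible_double af; have a2 := admissible_double a1.
have st1 y : `|y| < M -> ~ ((q \o f) @` B) y ->
    ((2 * a - ln 4)%:E <= log_average (q \o f) y)%E.
  move=> yM nB; have [n1 n2] := not_image_double yM nB.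
  have [z1 z2] := norm_half_angle yM.
  have := log_average_double_bound af yM (fa _ z1 n1) (fa _ z2 n2).
  by congr (_%:E <= _)%E; ring.
have st1' y : 0 < y -> `|y| < M -> ~ ((q \o f) @` B) y ->
    ((2 * a + delta - ln 4)%:E <= log_average (q \o f) y)%E.
  move=> y0 yM nB; have [n1 n2] := not_image_double yM nB.
  have [z1 z2] := norm_half_angle yM; have [/andP[h0 hM] qh] := half_angle yM.
  have hM2 : M / 2 <= h y.
    rewrite -(@ler_pXn2r _ 2) ?nnegrE ?(ltW h0) ?divr_ge0 ?(ltW M0)//.
    rewrite sqr_sqrtr; last by rewrite divr_ge0// mulr_ge0 ?(ltW M0)// addr_ge0 ?ltW.
    have -> : (M / 2) ^+ 2 = M * (M / 2) / 2 by field.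
    by rewrite ler_pM2r ?invr_gt0// ler_pM2l//; lra.
  (* The preimage whose sign is opposite to that of c is at distance at least h y >= M / 2 from
     c. *)
  have [hc|hc] := leP 0 c.
    have far : M / 2 <= `|- h y - c| by rewrite -opprD normrN gtr0_norm; lra.
    have := log_average_double_bound af yM (fa _ z1 n1) (fd _ z2 n2 far).
    by congr (_%:E <= _)%E; ring.
  have far : M / 2 <= `|h y - c| by rewrite gtr0_norm; lra.
  have := log_average_double_bound af yM (fd _ z1 n1 far) (fa _ z2 n2).
  by congr (_%:E <= _)%E; ring.
(* Second doubling: the preimage h z > 0 brings the bound with delta, - h z the one without. *)
have : 4 * a + delta - 3 * ln 4 <= ln 4.
  apply: (log_average_le_ln4 a2) => z zM nB.
  have [n1 n2] := not_image_double zM nB.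
  have [z1 z2] := norm_half_angle zM; have [/andP[h0 hM] _] := half_angle zM.
  have := log_average_double_bound a1 zM (st1' _ h0 z1 n1) (st1 _ z2 n2).
  by congr (_%:E <= _)%E; ring.
lra.
Qed.

End Doubling.

(** * Assembling the bound *)

Section PolynomialLipschitz.
Context {R : realType}.

Lemma norm_le_max_ends (l u x : R) : l <= x <= u -> `|x| <= Num.max `|l| `|u|.
Proof.
move=> /andP[lx xu]; rewrite ler_norml; apply/andP; split.
  rewrite lerNl le_max; apply/orP; left; rewrite -normrN.
  by apply: le_trans (ler_norm _); rewrite lerN2.
by rewrite le_max; apply/orP; right; apply: le_trans xu (ler_norm _).
Qed.

Lemma poly_bounded_lipschitz (P : {poly R}) (b : R) : 0 <= b ->
  exists K L, [/\ 0 < K, 0 < L, forall x, `|x| <= b -> `|P.[x]| <= K &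
    forall x t, `|x| <= b -> `|t| <= b -> `|P.[x] - P.[t]| <= L * `|x - t|].
Proof.
move=> b0; elim/poly_ind: P => [|P c [K [L [K0 L0 PK PL]]]].
  exists 1, 1; split=> // [x|x t] _; first by rewrite horner0 normr0.
  by move=> _; rewrite !horner0 subrr normr0 mul1r.
exists (K * b + `|c| + 1), (L * b + K); split=> [|||x t xb tb].
- by rewrite ltr_wpDl// addr_ge0// mulr_ge0// ltW.
- by rewrite ltr_wpDl// mulr_ge0// ltW.
- move=> x xb; rewrite !hornerE; apply: (le_trans (ler_normD _ _)).
  rewrite normrM -addrA lerD//; last by rewrite lerDl.
  by apply: ler_pM => //; exact: PK.
- rewrite !hornerE.
  have -> : P.[x] * x + c - (P.[t] * t + c) =
      (P.[x] - P.[t]) * x + P.[t] * (x - t) by ring.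
  apply: (le_trans (ler_normD _ _)); rewrite !normrM mulrDl lerD//.
    by rewrite mulrAC; apply: ler_pM => //; exact: PL.
  by rewrite ler_wpM2r// PK.
Qed.

End PolynomialLipschitz.

(** * Gaps of a compact set of reals *)

Section GapStructure.
Context {R : realType} (e : set R) (ce : compact e).

Definition is_gap (a b : R) := [/\ a < b, e a, e b &
  forall x, a < x < b -> ~ e x].

Lemma compact_has_max (A : set R) : compact A -> A !=set0 ->
  exists2 m, A m & forall x, A x -> x <= m.
Proof.
move=> cA A0; have cid : {within A, continuous (id : R -> R)}.
  by apply: continuous_subspaceT => x; exact: cvg_id.
have [m /set_mem Am mP] := compact_EVT_max A0 cA cid.
by exists m => // x /mem_set; exact: mP.
Qed.

Lemma compact_has_min (A : set R) : compact A -> A !=set0 ->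
  exists2 m, A m & forall x, A x -> m <= x.
Proof.
move=> cA A0; have cid : {within A, continuous (id : R -> R)}.
  by apply: continuous_subspaceT => x; exact: cvg_id.
have [m /set_mem Am mP] := compact_EVT_min A0 cA cid.
by exists m => // x /mem_set; exact: mP.
Qed.

Lemma gap_around l u r : e l -> e u -> l <= r <= u -> ~ e r ->
  exists a b, is_gap a b /\ a < r < b.
Proof.
move=> el eu /andP[lr ru] ner.
have cl : compact (e `&` [set x | x <= r]).
  by apply: compact_closedI => //; exact: closed_le.
have cu : compact (e `&` [set x | r <= x]).
  by apply: compact_closedI => //; exact: closed_ge.
have [a [ea /= ar] amax] := compact_has_max cl (ex_intro _ l (conj el lr)).
have [b [eb /= rb] bmin] := compact_has_min cu (ex_intro _ u (conj eu ru)).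
have ar' : a < r.
  by rewrite lt_neqAle ar andbT; apply/eqP => E; apply: ner; rewrite -E.
have rb' : r < b.
  by rewrite lt_neqAle rb andbT; apply/eqP => E; apply: ner; rewrite E.
exists a, b; split; last by rewrite ar'.
split => //; first exact: lt_trans rb'.
move=> x /andP[ax xb] ex; have [xr|rx] := leP x r.
  by have := amax x (conj ex xr); rewrite leNgt ax.
by have := bmin x (conj ex (ltW rx)); rewrite leNgt xb.
Qed.

Lemma gap_unique a b a' b' x : is_gap a b -> is_gap a' b' ->
  a < x < b -> a' < x < b' -> a = a' /\ b = b'.
Proof.
move=> [ab ea eb g] [ab' ea' eb' g'] /andP[ax xb] /andP[ax' xb'].
split; apply/eqP; rewrite eq_le; apply/andP; split; rewrite leNgt; apply/negP => h.
- by apply: (g' a) => //; rewrite h (lt_trans ax).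
- by apply: (g a') => //; rewrite h (lt_trans ax').
- by apply: (g b') => //; rewrite h (lt_trans ax xb').
- by apply: (g' b) => //; rewrite h (lt_trans ax' xb).
Qed.

Lemma gap_or_interval : infinite_set e ->
  exists l u, [/\ l < u, e l, e u, forall x, e x -> l <= x <= u &
    (exists a b, is_gap a b) \/ e = [set` `[l, u]]].
Proof.
move=> ie; have e0 : e !=set0.
  by apply/set0P/eqP => E; apply: ie; rewrite E; exact: finite_set0.
have [l el lmin] := compact_has_min ce e0.
have [u eu umax] := compact_has_max ce e0.
have elu x : e x -> l <= x <= u by move=> ex; rewrite lmin// umax.
have lu : l < u.
  rewrite lt_neqAle lmin// andbT; apply/eqP => E; apply: ie.
  apply: (sub_finite_set (B := [set l])); last exact: finite_set1.
  by move=> x /elu /andP[lx xu]; apply/eqP; rewrite eq_le lx E xu.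
exists l, u; split => //.
have [|full] := pselect (exists r, l <= r <= u /\ ~ e r).
  by move=> [r [lru ner]]; left; have [a [b [g _]]] := gap_around el eu lru ner; exists a, b.
right; apply/seteqP; split => [x /elu|x]; first by rewrite /= in_itv.
rewrite /= in_itv /= => xlu; apply: contrapT => nex; apply: full.
by exists x.
Qed.

End GapStructure.

Section ParreauWidom.
Context {R : realType} (e : set R) (rho : probability (measurableTypeR R) R).

Lemma PW_ge_sum (s : seq R[i]) (g : R[i] -> R) : uniq s ->
  (forall z, z \in s -> green_critical e rho z /\ green e rho z = (g z)%:E) ->
  ((\sum_(z <- s) g z)%:E <= PW e rho)%E.
Proof.
move=> us sP; apply: esum_ge; exists [set` s].
  by split => [|z /= /sP[]]; first exact: finite_seq.
rewrite -fsbig_seq// -sumEFin big_seq [leRHS]big_seq.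
by apply: lee_sum => z /sP[_ <-]; exact: lexx.
Qed.

Lemma PW_ge0 : (0 <= PW e rho)%E.
Proof. by have := @PW_ge_sum [::] (fun=> 0) isT; rewrite big_nil; apply. Qed.

End ParreauWidom.

Section RootSum.
Context {R : realType} (e : set R) (rho : probability (measurableTypeR R) R).
Context (l u C rr p : R) (ce : compact e) (el : e l) (eu : e u)
  (elu : forall x, e x -> l <= x <= u) (C1 : 1 <= C) (luC : u - l <= C)
  (req : is_equilibrium e rho) (rrE : robin e = rr%:E)
  (hreg : gap_regular e rho) (pE : PW e rho = p%:E).

Let me : measurable (e : set (measurableTypeR R)).
Proof. exact: compact_measurable. Qed.

Let hullC x t : l <= x <= u -> e t -> `|x - t| <= C.
Proof.
move=> /andP[lx xu] /elu /andP[lt tu]; have := luC.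
by rewrite ler_norml => ?; apply/andP; split; lra.
Qed.

Lemma gap_endpoint_logpot x : e x -> green e rho x%:C = 0%E ->
  logpot C rho x = (rr + ln C)%:E.
Proof.
move=> /elu ex; rewrite /green rrE (potentialE me req.1 C1); last first.
  by move=> t; exact: hullC.
case: (logpot C rho x) => [v| |]//=.
by rewrite -!EFinB => -[h]; congr EFin; lra.
Qed.

Lemma gap_maximum a b : is_gap e a b -> exists w c gam,
  [/\ a < w < b, 0 < c, green_critical e rho w%:C,
      green e rho w%:C = gam%:E &
      forall x, a <= x <= b ->
        ((rr + ln C - gam + c * (x - w) ^+ 2)%:E <= logpot C rho x)%E].
Proof.
move=> [ab ea eb g]; have [ga gb] := hreg ab ea eb g.
have /andP[la _] := elu ea; have /andP[_ bu] := elu eb.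
apply: (gap_critical_point me req.1 C1) => //.
- move=> x t /andP[ax xb]; apply: hullC.
  by rewrite (le_trans la)// (le_trans xb).
- move=> t et; have [ta|at_] := leP t a; [by left|right].
  by rewrite leNgt; apply/negP => tb; apply: (g t) => //; rewrite at_.
- exact: gap_endpoint_logpot.
- exact: gap_endpoint_logpot.
Qed.

(* When e has a gap, c is the value of P at the maximum w0 of the Green's
   function over one fixed gap: if y is far from c, then no root of P - y is
   close to w0, and the estimate by the full sum PW is off by at least delta. *)
Lemma roots_logpot_sum_ge (P : {poly R}) (M : R) : 0 < M ->
  extremal e P M -> (1 < size P)%N ->
  exists c delta, [/\ 0 <= delta, (exists a b, is_gap e a b) -> 0 < delta &
   forall y rs, `|y| < M -> P - y%:P = \prod_(r <- rs) ('X - r%:P) ->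
     (forall r, r \in rs -> e r -> ((rr + ln C)%:E <= logpot C rho r)%E) ->
     (((size rs)%:R * (rr + ln C) - p)%:E <= \sum_(r <- rs) logpot C rho r)%E /\
     (M / 2 <= `|y - c| ->
       (((size rs)%:R * (rr + ln C) - p + delta)%:E
          <= \sum_(r <- rs) logpot C rho r)%E)].
Proof.
move=> M0 ext sP; have e0 : e !=set0 by exists l.
(* The critical point is chosen as a function of the gap alone, so that equal critical points mean
   equal gaps. Pairs that are not gaps get dummy values. *)
have [F FP] : exists F : R * R -> R * R * R, forall ab, is_gap e ab.1 ab.2 ->
   [/\ ab.1 < (F ab).1.1 < ab.2, 0 < (F ab).1.2,
       green_critical e rho ((F ab).1.1)%:C,
       green e rho ((F ab).1.1)%:C = ((F ab).2)%:E &
       forall x, ab.1 <= x <= ab.2 ->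
        ((rr + ln C - (F ab).2 + (F ab).1.2 * (x - (F ab).1.1) ^+ 2)%:E
           <= logpot C rho x)%E].
  suff /choice[F FP] : forall ab : R * R, exists q : R * R * R,
   is_gap e ab.1 ab.2 ->
   [/\ ab.1 < q.1.1 < ab.2, 0 < q.1.2, green_critical e rho (q.1.1)%:C,
       green e rho (q.1.1)%:C = (q.2)%:E &
       forall x, ab.1 <= x <= ab.2 ->
        ((rr + ln C - q.2 + q.1.2 * (x - q.1.1) ^+ 2)%:E <= logpot C rho x)%E].
    by exists F.
  move=> [a b] /=; have [g|ng] := pselect (is_gap e a b); last by exists (0, 0, 0).
  by have [w [c [gam H]]] := gap_maximum g; exists (w, c, gam).
have [G GP] : exists G : R -> R * R, forall r, l <= r <= u -> ~ e r ->
    is_gap e (G r).1 (G r).2 /\ (G r).1 < r < (G r).2.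
  suff /choice[G GP] : forall r : R, exists ab : R * R, l <= r <= u -> ~ e r ->
      is_gap e ab.1 ab.2 /\ ab.1 < r < ab.2 by exists G.
  move=> r.
  have [lru|nlru] := pselect (l <= r <= u); last by exists (0, 0).
  have [er|ner] := pselect (e r); first by exists (0, 0).
  by have [a [b H]] := gap_around ce el eu lru ner; exists (a, b).
pose w r := (F (G r)).1.1; pose k r := (F (G r)).1.2; pose gam r := (F (G r)).2.
have Guniq r a b : l <= r <= u -> ~ e r -> is_gap e a b ->
    a < w r < b \/ a < r < b -> G r = (a, b).
  move=> lru ner gab; have [gr rG] := GP r lru ner.
  have [wG _ _ _ _] := FP _ gr.
  case=> [wab|rab].
    by have [<- <-] := gap_unique gr gab wG wab; case: (G r).
  by have [<- <-] := gap_unique gr gab rG rab; case: (G r).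
have b0 : 0 <= Num.max `|l| `|u| by rewrite le_max normr_ge0.
have [K [L [_ L0 _ PL]]] := poly_bounded_lipschitz P b0.
have base y rs (yM : `|y| < M) (PE : P - y%:P = \prod_(r <- rs) ('X - r%:P))
     (Ve : forall r, r \in rs -> e r -> ((rr + ln C)%:E <= logpot C rho r)%E) :
     let J := [seq r <- rs | r \notin e] in
     [/\ forall r, r \in rs -> l <= r <= u,
      uniq [seq (w r)%:C | r <- J],
      forall z, z \in [seq (w r)%:C | r <- J] ->
        green_critical e rho z /\ green e rho z = (fine (green e rho z))%:E,
      \sum_(z <- [seq (w r)%:C | r <- J]) fine (green e rho z) =
        \sum_(r <- J) gam r &
      (((size rs)%:R * (rr + ln C) - \sum_(r <- J) gam r
          + \sum_(r <- J) k r * (r - w r) ^+ 2)%:E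
        <= \sum_(r <- rs) logpot C rho r)%E].
  move=> J.
  have hull r : r \in rs -> l <= r <= u.
    exact: (extremal_roots_in_hull ce e0 ext yM sP PE elu).
  have JP r : r \in J -> [/\ r \in rs, l <= r <= u & ~ e r].
    by rewrite mem_filter => /andP[/negP nre rrs]; split => //;
      [exact: hull|move=> /mem_set].
  have JF r : r \in J -> _ := fun rJ => let: And3 _ h1 h2 := JP r rJ in
    FP _ (GP r h1 h2).1.
  split => //.
  (* Two roots with the same critical point lie in the same gap, and then (x - r)(x - r') > 0 on
     [e]. *)
  - apply/negPn/negP => /not_uniq_map_perm[r [r' [s [ps]]]].
    move=> /(congr1 (@complex.Re R)) /= wrr'.
    have [rrs hr ner] : [/\ r \in rs, l <= r <= u & ~ e r].
      by apply: JP; rewrite (perm_mem ps) inE eqxx.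
    have [r'rs hr' ner'] : [/\ r' \in rs, l <= r' <= u & ~ e r'].
      by apply: JP; rewrite (perm_mem ps) !inE eqxx orbT.
    have [gr rG] := GP r hr ner; have [gr' r'G] := GP r' hr' ner'.
    have [wG _ _ _ _] := FP _ gr; have [wG' _ _ _ _] := FP _ gr'.
    rewrite -/(w r) -/(w r') in wG wG'; rewrite -wrr' in wG'.
    have [E1 E2] := gap_unique gr gr' wG wG'.
    have ps' : perm_eq rs [:: r, r' & s ++ [seq r <- rs | r \in e]].
      have -> : [seq r <- rs | r \in e] = [seq r <- rs | predC (fun r => r \notin e) r].
        by apply: eq_filter => z /=; rewrite negbK.
      rewrite -!cat_cons.
      apply: (@perm_trans _ (J ++ [seq r <- rs | predC (fun r => r \notin e) r])).
        by rewrite perm_sym perm_filterC.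
      by rewrite perm_cat2r.
    rewrite (perm_big _ ps') in PE.
    apply: (extremal_roots_separated ce e0 ext yM sP PE) => x ex.
    have [_ _ _ g] := gr; move: rG r'G; rewrite -E1 -E2.
    move=> /andP[ar rb] /andP[ar' r'b].
    have [xa|ax] := leP x (G r).1.
      by rewrite nmulr_lgt0 subr_lt0; apply: le_lt_trans xa _.
    have bx : (G r).2 <= x by rewrite leNgt; apply/negP => xb; apply: (g x); rewrite ?ax.
    by rewrite mulr_gt0// subr_gt0; [exact: lt_le_trans rb bx|exact: lt_le_trans r'b bx].
  - move=> z /mapP[r rJ ->]; have [_ _ h1 h2 _] := JF r rJ.
    by split => //; rewrite -/(w r) in h2; rewrite h2.
  - rewrite big_map big_seq [RHS]big_seq; apply: eq_bigr => r rJ.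
    by have [_ _ _ h2 _] := JF r rJ; rewrite -/(w r) in h2; rewrite h2.
  have -> : (size rs)%:R * (rr + ln C) - \sum_(r <- J) gam r
          + \sum_(r <- J) k r * (r - w r) ^+ 2 =
      \sum_(r <- rs) (rr + ln C - (if r \notin e then gam r - k r * (r - w r) ^+ 2 else 0)).
    rewrite sumrB big_const_seq count_predT iter_addr addr0 -big_mkcond /=.
    by rewrite /J !big_filter sumrB mulr_natl; ring.
  rewrite -sumEFin big_seq [leRHS]big_seq; apply: lee_sum => r rrs.
  case: ifPn => [nre|/negPn /set_mem er]; last by rewrite subr0; exact: Ve.
  have rJ : r \in J by rewrite mem_filter nre.
  have [_ h1 h2] := JP r rJ; have [_ rG] := GP r h1 h2; have [_ _ _ _ h3] := JF r rJ.
  have /andP[/ltW Gr /ltW rG2] := rG.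
  by have := h3 r; rewrite Gr rG2 => /(_ isT); congr (_%:E <= _)%E; rewrite opprB addrA addrAC.
have k0 y rs : `|y| < M -> P - y%:P = \prod_(r <- rs) ('X - r%:P) ->
    (forall r, r \in rs -> l <= r <= u) ->
    forall r, r \in [seq r <- rs | r \notin e] -> 0 <= k r * (r - w r) ^+ 2.
  move=> yM PE hull r; rewrite mem_filter => /andP[/negP nre rrs].
  have ner : ~ e r by move=> /mem_set.
  have [_ h _ _ _] := FP _ (GP r (hull r rrs) ner).1.
  by rewrite mulr_ge0 ?sqr_ge0// ltW.
have weak y rs : `|y| < M -> P - y%:P = \prod_(r <- rs) ('X - r%:P) ->
     (forall r, r \in rs -> e r -> ((rr + ln C)%:E <= logpot C rho r)%E) ->
     (((size rs)%:R * (rr + ln C) - p)%:E <= \sum_(r <- rs) logpot C rho r)%E.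
  move=> yM PE Ve; have [hull us sG sumE lbE] := base y rs yM PE Ve.
  apply: le_trans lbE; rewrite lee_fin.
  have := PW_ge_sum us sG; rewrite pE lee_fin sumE.
  have : 0 <= \sum_(r <- rs | r \notin e) k r * (r - w r) ^+ 2.
    rewrite -big_filter big_seq; apply: sumr_ge0 => r.
    exact: (k0 y rs yM PE hull).
  rewrite !big_filter; set S1 := \sum_(_ <- _ | _) k _ * _.
  by set S2 := \sum_(_ <- _ | _) gam _; set S3 := _%:R * _; lra.
have [[a [b gab]]|ngap] := pselect (exists a b, is_gap e a b); last first.
  exists 0, 0; split => // y rs yM PE Ve; split; first exact: (weak y).
  by move=> _; rewrite addr0; exact: (weak y).
have [w0ab c0 crit0 green0 V0] := FP (a, b) gab.
pose w0 := (F (a, b)).1.1; pose gam0 := (F (a, b)).2; pose c1 := (F (a, b)).1.2.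
rewrite -/w0 -/gam0 -/c1 /= in w0ab c0 crit0 green0 V0.
have [ab ea eb nab] := gab.
have gam00 : 0 < gam0.
  have := V0 a; rewrite lexx (ltW ab) => /(_ isT).
  have [ga _] := hreg ab ea eb nab; rewrite (gap_endpoint_logpot ea ga) lee_fin.
  have : 0 < c1 * (a - w0) ^+ 2.
    rewrite mulr_gt0// -sqrrN opprB exprn_gt0// subr_gt0.
    by case/andP: w0ab.
  by set S := c1 * _; lra.
(* If the gap contains no root, its term gam0 of the full sum is left over. If it contains a root r,
   then M / 2 <= |P(r) - P(w0)| <= L |r - w0|, and the quadratic loss is at least the second
   entry. *)
pose delta := Num.min gam0 (c1 * (M / (2 * L)) ^+ 2).
have delta0 : 0 < delta.
  by rewrite lt_min gam00 mulr_gt0// exprn_gt0// divr_gt0// mulr_gt0.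
exists P.[w0], delta; split => //; first exact: ltW.
move=> y rs yM PE Ve; split; first exact: (weak y).
move=> far; have [hull us sG sumE lbE] := base y rs yM PE Ve.
apply: le_trans lbE; rewrite lee_fin.
have kpos := k0 y rs yM PE hull.
set J := [seq r <- rs | r \notin e] in us sG sumE kpos *.
have JP r : r \in J -> [/\ r \in rs, l <= r <= u & ~ e r].
  by rewrite mem_filter => /andP[/negP nre rrs]; split => //;
    [exact: hull|move=> /mem_set].
have [/hasP[r rJ rab]|nhas] := boolP (has (fun r => a < r < b) J).
  have [rrs hr ner] := JP r rJ.
  have Gr : G r = (a, b) by apply: Guniq => //; right.
  have Pr : P.[r] = y.
    have : root (P - y%:P) r by rewrite PE root_prod_XsubC.
    by rewrite /root !hornerE subr_eq0 => /eqP.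
  have dr : delta <= k r * (r - w r) ^+ 2.
    rewrite /k /w Gr -/w0 -/c1 /delta ge_min; apply/orP; right.
    rewrite ler_pM2l// -[leRHS]real_normK ?num_real//.
    rewrite lerXn2r ?nnegrE ?divr_ge0 ?mulr_ge0 ?(ltW M0) ?(ltW L0)//.
    have hw0 : l <= w0 <= u.
      have /andP[la _] := elu ea; have /andP[_ bu] := elu eb.
      have /andP[aw wb] := w0ab.
      by rewrite (le_trans la (ltW aw)) (le_trans (ltW wb) bu).
    have := PL r w0 (norm_le_max_ends hr) (norm_le_max_ends hw0); rewrite Pr => h.
    rewrite invfM mulrA ler_pdivrMr// [leRHS]mulrC.
    exact: le_trans far h.
  have : k r * (r - w r) ^+ 2 <= \sum_(r <- J) k r * (r - w r) ^+ 2.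
    rewrite (big_rem r rJ) /= lerDl big_seq; apply: sumr_ge0 => z zJ.
    by apply: kpos; exact: mem_rem zJ.
  have := PW_ge_sum us sG; rewrite pE lee_fin sumE.
  set S1 := \sum_(_ <- _) k _ * _; set S2 := \sum_(_ <- _) gam _.
  by set S3 := _%:R * _; set S4 := k r * _ in dr *; lra.
have us' : uniq (w0%:C :: [seq (w r)%:C | r <- J]).
  rewrite /= us andbT; apply/mapP => -[r rJ /(congr1 (@complex.Re R)) /= w0r].
  have [rrs hr ner] := JP r rJ.
  have Gr : G r = (a, b) by apply: Guniq => //; left; rewrite -w0r.
  have [_] := GP r hr ner; rewrite Gr /= => rab.
  by move/hasPn: nhas => /(_ r rJ); rewrite rab.
have sG' z : z \in w0%:C :: [seq (w r)%:C | r <- J] ->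
    green_critical e rho z /\ green e rho z = (fine (green e rho z))%:E.
  by rewrite inE => /orP[/eqP ->|/sG//]; split => //; rewrite green0.
have := PW_ge_sum us' sG'; rewrite pE lee_fin big_cons sumE green0 /=.
have : 0 <= \sum_(r <- J) k r * (r - w r) ^+ 2.
  by rewrite big_seq; apply: sumr_ge0 => r; exact: kpos.
have : delta <= gam0 by rewrite /delta ge_min lexx.
set S1 := \sum_(_ <- _) k _ * _; set S2 := \sum_(_ <- _) gam _.
by set S3 := _%:R * _; lra.
Qed.


End RootSum.

Section ChebyshevBound.
Context {R : realType}.
Implicit Types (e : set R) (rho : probability (measurableTypeR R) R).

Lemma extremal_gt0 e (P : {poly R}) (M : R) : infinite_set e ->
  extremal e P M -> 0 < M.
Proof.
move=> ie [mP PM _].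
have [B Be sB] := infinite_set_fset (size P) ie.
have [x ex Px] : exists2 x, e x & P.[x] != 0.
  apply/not_exists2P => H.
  have allr : all (root P) (finmap.enum_fset B).
    apply/allP => x xB; case: (H x) => [nex|/negP/negPn//].
    by exfalso; apply: nex; exact: Be.
  have := max_poly_roots (monic_neq0 mP) allr (finmap.fset_uniq B).
  by rewrite ltnNge sB.
by apply: lt_le_trans (PM x ex); rewrite normr_gt0.
Qed.

(** If there is a gap, regularity makes G vanish at its endpoint, and +oo - x is never 0. Otherwise
    [e] is an interval and has positive measure. *)
Lemma robin_finite e rho : compact e -> infinite_set e ->
  is_equilibrium e rho -> gap_regular e rho -> exists rr, robin e = rr%:E.
Proof.
move=> ce ie req hreg; have [l [u [lu el eu elu gapi]]] := gap_or_interval ce ie.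
have me : measurable (e : set (measurableTypeR R)) by exact: compact_measurable.
have C1 : 1 <= 1 + (u - l) by rewrite lerDl subr_ge0 ltW.
have eC x t : e x -> e t -> `|x - t| <= 1 + (u - l).
  move=> /elu /andP[lx xu] /elu /andP[lt tu].
  by rewrite ler_norml; apply/andP; split; lra.
have Ny := robin_gtNy me C1 eC.
have : (robin e < +oo)%E.
  case: gapi => [[a [b [ab ea eb g]]]|eE].
    have [+ _] := hreg a b ab ea eb g.
    rewrite /green; case: (robin e) => [r _| |//]; first by rewrite ltry.
    by case: (potential _ _).
  apply: (robin_lty me C1 eC); rewrite eE lebesgue_measure_itv /= lte_fin lu.
    by rewrite -EFinB lte_fin subr_gt0.
  by rewrite -EFinB ltry.
by move: Ny; case: (robin e) => // r _ _; exists r.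
Qed.

Lemma measurable_horner (P : {poly R}) :
  measurable_fun [set: measurableTypeR R] (horner P).
Proof.
by apply: continuous_measurable_fun => x; exact: continuous_horner.
Qed.

Lemma kap_prod C (rs : seq R) t : (forall r, r \in rs -> `|t - r| <= C) ->
  (\sum_(r <- rs) kap C (r - t) = kap (C ^+ size rs) (\prod_(r <- rs) (t - r)))%E.
Proof.
elim: rs => [_|r rs IH rC].
  rewrite !big_nil expr0 kapE ?oner_neq0 ?normr1//.
  by rewrite subrr.
rewrite !big_cons IH => [|r' r'rs]; last by apply: rC; rewrite inE r'rs orbT.
rewrite /= exprS kapM -?[r - t]opprB ?kapN//; first by apply: rC; rewrite inE eqxx.
have {}rC r' : r' \in rs -> `|t - r'| <= C by move=> h; apply: rC; rewrite inE h orbT.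
elim: rs rC {IH} => [|r' rs IH] rC; first by rewrite big_nil normr1.
rewrite big_cons normrM exprS ler_pM//; first by apply: rC; rewrite inE eqxx.
by apply: IH => r'' h; apply: rC; rewrite inE h orbT.
Qed.

(** The factorisation of P(t) - y, integrated. The constant passes from the normalisation C of each
    factor to 2M for the product; it is nonnegative because 2M <= C <= C^n for n >= 1. *)
Lemma log_average_roots e rho (P : {poly R}) (M C y : R) (rs : seq R) :
  measurable (e : set (measurableTypeR R)) -> supported_on e rho ->
  0 < M -> 1 <= C -> 2 * M <= C -> `|y| < M -> (0 < size rs)%N ->
  (forall t, e t -> `|P.[t]| <= M) ->
  P - y%:P = \prod_(r <- rs) ('X - r%:P) ->
  (forall r t, r \in rs -> e t -> `|t - r| <= C) ->
  (\sum_(r <- rs) logpot C rho r =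
   log_average rho M (horner P) y + ((size rs)%:R * ln C - ln (2 * M))%:E)%E.
Proof.
move=> me rhoe M0 C1 MC yM s0 PM PE rC.
have C0 : 0 < C by exact: lt_le_trans C1.
have M2 : 0 < 2 * M by rewrite mulr_gt0.
have MCn : 2 * M <= C ^+ size rs.
  by apply: (le_trans MC); rewrite -[leLHS]expr1 ler_weXn2l.
have lnE : (size rs)%:R * ln C - ln (2 * M) = ln (C ^+ size rs) - ln (2 * M).
  by rewrite lnXn// mulr_natl.
have ln0 : 0 <= ln (C ^+ size rs) - ln (2 * M).
  by rewrite subr_ge0 ler_ln ?posrE ?exprn_gt0.
rewrite lnE /logpot -ge0_integral_sum//; last 2 first.
- by move=> r; exact: measurable_kapB.
- by move=> r t _; exact: kap_ge0.
rewrite /log_average -[X in (_ + X)%E](integral_prob_cst rho) -ge0_integralD//; last 2 first.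
- by move=> t _; exact: kap_ge0.
- apply: (measurableT_comp (measurable_kap _)); apply: measurable_funB => //.
  exact: measurable_horner.
apply: (supported_ae_eq_integral me rhoe).
- by apply: emeasurable_sum => r; exact: measurable_kapB.
- apply: emeasurable_funD => //.
  apply: (measurableT_comp (measurable_kap _)); apply: measurable_funB => //.
  exact: measurable_horner.
move=> t et; rewrite kap_prod; last by move=> r rrs; exact: rC.
have -> : \prod_(r <- rs) (t - r) = P.[t] - y.
  have := congr1 (horner^~ t) PE; rewrite hornerD hornerN hornerC horner_prod => ->.
  by apply: eq_bigr => r _; rewrite !hornerE.
have b : `|P.[t] - y| <= 2 * M.
  have := PM t et; move: yM; rewrite ltr_norml !ler_norml => /andP[? ?] /andP[? ?].
  by apply/andP; split; lra.
have b' := le_trans b MCn.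
have [->|n0] := eqVneq (P.[t] - y) 0; first by rewrite /kap eqxx.
by rewrite !kapE// -EFinD; congr EFin; ring.
Qed.

(** Logarithmic form of the theorem in positive degree: a gap improves the bound for M by the factor
    exp (- delta / 4) < 1. *)
Lemma extremal_log_bound e rho (P : {poly R}) (M p : R) :
  compact e -> infinite_set e -> is_equilibrium e rho -> gap_regular e rho ->
  extremal e P M -> (1 < size P)%N -> PW e rho = p%:E ->
  exists rr delta, [/\ robin e = rr%:E, 0 <= delta,
    (exists a b, is_gap e a b) -> 0 < delta &
    4 * ((size P).-1%:R * rr - p + ln M - ln 2) + delta <= 0].
Proof.
move=> ce ie req hreg ext sP pE.
have [rr rrE] := robin_finite ce ie req hreg.
have M0 := extremal_gt0 ie ext.
have [l [u [lu el eu elu gapi]]] := gap_or_interval ce ie.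
have me : measurable (e : set (measurableTypeR R)) by exact: compact_measurable.
pose C := 1 + (u - l) + 2 * M.
have ul0 : 0 <= u - l by rewrite subr_ge0 ltW.
have M20 : 0 <= 2 * M by rewrite mulr_ge0// ltW.
have C1 : 1 <= C by rewrite /C; lra.
have luC : u - l <= C by rewrite /C; lra.
have MC : 2 * M <= C by rewrite /C; lra.
have hullC x t : l <= x <= u -> l <= t <= u -> `|x - t| <= C.
  by move=> /andP[? ?] /andP[? ?]; rewrite ler_norml; apply/andP; split; lra.
have e0 : e !=set0 by exists l.
pose B := [set x | e x /\ (logpot C rho x < (rr + ln C)%:E)%E].
have B0 : lebesgue_measure.-negligible B.
  apply: (low_potential_negligible me _ C1 _ req rrE).
    apply: (@le_lt_trans _ _ (lebesgue_measure (`[l, u]%classic : set R))).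
      by apply: le_outer_measure => x /elu; rewrite /= in_itv.
    by rewrite lebesgue_measure_itv /= lte_fin lu -EFinB ltry.
  by move=> x t /elu ? /elu ?; exact: hullC.
have [c [delta [d0 dgap dP]]] :=
  roots_logpot_sum_ge ce el eu elu C1 luC req rrE hreg pE M0 ext sP.
exists rr, delta; split => //.
pose n := (size P).-1.
pose a := n%:R * rr - p + ln (2 * M).
have adm : admissible e M (horner P).
  split; [exact: measurable_horner|by case: ext|].
  have m0 : 0 <= Num.max `|l| `|u| by rewrite le_max normr_ge0.
  have [K [L [_ L0 _ PL]]] := poly_bounded_lipschitz P m0.
  exists L => // x t /elu /norm_le_max_ends hx /elu /norm_le_max_ends ht.
  exact: PL.
(* For y outside P(B), every root of P - y that lies in [e] has G <= 0, so only roots in gaps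
   contribute positively to the sum of G. *)
have key y : `|y| < M -> ~ (horner P @` B) y ->
    (a%:E <= log_average rho M (horner P) y)%E /\
    (M / 2 <= `|y - c| -> ((a + delta)%:E <= log_average rho M (horner P) y)%E).
  move=> yM nB; have [rs srs PE] := extremal_real_roots ce e0 ext yM sP.
  have rsr r : r \in rs -> P.[r] = y.
    move=> rrs; have : root (P - y%:P) r by rewrite PE root_prod_XsubC.
    by rewrite /root !hornerE subr_eq0 => /eqP.
  have Ve r : r \in rs -> e r -> ((rr + ln C)%:E <= logpot C rho r)%E.
    move=> rrs er; rewrite leNgt; apply/negP => h; apply: nB.
    by exists r; [split|exact: rsr].
  have hull r : r \in rs -> l <= r <= u.
    exact: (extremal_roots_in_hull ce e0 ext yM sP PE elu).
  have s0 : (0 < size rs)%N by rewrite srs -ltnS prednK// ltnW.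
  have [_ PM _] := ext.
  have rC r t : r \in rs -> e t -> `|t - r| <= C.
    by move=> /hull hr /elu ht; exact: hullC.
  have LA := log_average_roots me req.1 M0 C1 MC yM s0 PM PE rC.
  have [h1 h2] := dP y rs yM PE Ve; move: h1 h2; rewrite LA srs -/n.
  have aE x : ((n%:R * (rr + ln C) - p + x)%:E <=
      log_average rho M (horner P) y + (n%:R * ln C - ln (2 * M))%:E)%E ->
      ((a + x)%:E <= log_average rho M (horner P) y)%E.
    rewrite -leeBlDr// -EFinB; congr (_%:E <= _)%E; rewrite /a; ring.
  split; first by rewrite -[a]addr0; apply: aE; rewrite addr0.
  by move=> /h2; exact: aE.
have Be : B `<=` e by move=> x [].
have := log_average_gain me req.1 M0 Be B0 adm d0
  (fun y yM nB => (key y yM nB).1) (fun y yM nB => (key y yM nB).2).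
rewrite /a lnM ?posrE//.
have -> : ln 4 = ln 2 + ln 2 :> R by rewrite -lnM ?posrE//; congr ln; ring.
rewrite -/n; lra.
Qed.

End ChebyshevBound.

Theorem theorem4p3 (R : realType) (e : set R)
    (rho : probability (measurableTypeR R) R) (n : nat) (T : {poly R[i]})
    (he : compact e) (he_inf : infinite_set e)
    (hrho : is_equilibrium e rho) (hreg : gap_regular e rho)
    (hT : is_chebyshev e n T) :
  ((sup_norm e T)%:E <= 2%:E * expeR (PW e rho) * capacity e ^+ n)%E /\
  ((sup_norm e T)%:E = (2%:E * expeR (PW e rho) * capacity e ^+ n)%E ->
   exists a b : R, a < b /\ e = [set` `[a, b]]).
Proof.
have e0 : e !=set0.
  by apply/set0P/eqP => E; apply: he_inf; rewrite E; exact: finite_set0.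
have [P sP ext] := is_chebyshev_extremal he e0 hT.
set M := sup_norm e T in ext *.
have M0 := extremal_gt0 he_inf ext.
have [rr rrE] := robin_finite he he_inf hrho hreg.
have capE : (capacity e ^+ n = (expR (n%:R * - rr))%:E)%E.
  by rewrite /capacity rrE /= -EFin_expe expRM_natl.
have PW0 := PW_ge0 e rho.
rewrite capE.
have [pE|poo] : PW e rho = +oo%E \/ exists p, PW e rho = p%:E.
- by move: PW0; case: (PW e rho) => [p _| |//]; [right; exists p|left].
(* The right-hand side is +oo, which a finite norm cannot equal. *)
- rewrite pE /= gt0_muley ?lte_fin// gt0_mulye ?lte_fin ?expR_gt0//.
  by split; [rewrite leey|].
have [p pE] := poo; rewrite pE /= -!EFinM lee_fin.
have rhsE : 2 * expR p * expR (n%:R * - rr) = expR (ln 2 + p - n%:R * rr).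
  by rewrite !expRD lnK ?posrE// mulrN.
rewrite rhsE -(lnK (_ : M \is Num.pos))// ler_expR.
(* For n = 0 the polynomial is 1, so M <= 1 < 2 and equality is impossible. *)
have [n0|n0] := posnP n.
  have P1 : P = 1.
    have [mP _ _] := ext; move: sP; rewrite n0 => /eqP/size_poly1P[c c0 PE].
    by move: mP; rewrite PE monicE lead_coefC => /eqP ->.
  have M1 : M <= 1.
    have [mP _ minP] := ext; apply: (minP P) => // x _.
    by rewrite P1 hornerC normr1.
  have p0 : 0 <= p by move: PW0; rewrite pE lee_fin.
  have lM : ln M <= 0 by apply: ln_le0.
  have l2 : 0 < ln 2 :> R by rewrite ln_gt0// ltr1n.
  rewrite n0 mul0r subr0; split; first by lra.
  by move=> [/expR_inj]; lra.
have sP1 : (1 < size P)%N by rewrite sP ltnS.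
have [rr' [delta [rr'E d0 dgap]]] := extremal_log_bound he he_inf hrho hreg ext sP1 pE.
have <- : rr = rr' by apply: EFin_inj; rewrite -rrE.
rewrite sP /= => bound; split; first by lra.
move=> [/expR_inj] lE.
have [l [u [lu _ _ _ [gap|eE]]]] := gap_or_interval he he_inf; last by exists l, u.
by have := dgap gap; lra.
Qed.
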